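(* Every Henselian non-trivially valued field $K$, regarded as a topological field with its valuation topology, satisfies the density property.
   Context: A Henselian non-trivially valued field is a field $K$ with a non-trivial valuation (of arbitrary rank) whose valuation ring is a Henselian local ring. For a topological field $K$ and a $K$-variety $X$, the $K$-topology on the set $X(K)$ of $K$-rational points is the topology induced by that of $K$ (on affine pieces, the subspace topology from $K^n$). A topological field $K$ satisfies the density property if the following equivalent conditions hold: (1) If $X$ is a smooth, irreducible $K$-variety and $\emptyset\neq U\subset X$ is a Zariski open subset, then $U(K)$ is dense in $X(K)$ in the $K$-topology. (2) If $C$ is a smooth, irreducible $K$-curve and $\emptyset\neq U\subset C$ is a Zariski open subset, then $U(K)$ is dense in $C(K)$ in the $K$-topology. (3) If $C$ is a smooth, irreducible $K$-curve, then $C(K)$ has no isolated points (in the $K$-topology). *)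

(* Defs.v *)
From HB Require Import structures.
From mathcomp Require Import all_boot all_order all_algebra.
From mathcomp Require Import boolp classical_sets topology tvs.
(* The notations of mpoly clash with those of mathcomp-analysis. *)
From mathcomp Require Export -(notations) mpoly.

Set Implicit Arguments.
Unset Strict Implicit.
Unset Printing Implicit Defensive.

Import Order.TTheory GRing.Theory.
Local Open Scope classical_set_scope.
Local Open Scope ring_scope.

(** * Topological fields *)

HB.mixin Record isTopologicalField K & GRing.Field K & TopologicalZmodule K := {
  mulf_continuous : continuous (fun x : K * K => x.1 * x.2);
  invf_continuous :
    forall x : K, x != 0 -> {for x, continuous (fun y : K => y^-1)}
}.

#[short(type="topologicalFieldType")]
HB.structure Definition TopologicalField :=
  {K of GRing.Field K & TopologicalZmodule K & isTopologicalField K}.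

(** * Valuations of arbitrary rank *)

HB.mixin Record POrderedZmodule_isOrderedGroup G & Num.POrderedZmodule G := {
  ordered_group_total : total (<=%R : rel G);
  ordered_group_leD2r : forall z x y : G, x <= y -> x + z <= y + z
}.

#[short(type="orderedGroupType")]
HB.structure Definition OrderedGroup :=
  {G of Num.POrderedZmodule G & POrderedZmodule_isOrderedGroup G}.

(* The convention v(0) = +oo is rendered by never evaluating v at 0: the value
   [v 0] is junk. *)
Record valuation (K : fieldType) (G : orderedGroupType) := Valuation {
  valuation_fun :> K -> G;
  valuationM : forall x y : K, x != 0 -> y != 0 ->
    valuation_fun (x * y) = valuation_fun x + valuation_fun y;
  valuationD : forall x y : K, x != 0 -> y != 0 -> x + y != 0 ->
    Order.min (valuation_fun x) (valuation_fun y) <= valuation_fun (x + y)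
}.

Definition nontrivial_valuation (K : fieldType) (G : orderedGroupType)
    (v : valuation K G) : Prop :=
  exists2 x : K, x != 0 & v x != 0.

(* The radii range over the values actually taken by v on K^*: G may be larger
   than the value group v(K^* ), and a radius exceeding all of v(K^* ) would make
   the topology discrete. *)
Definition valuation_ball (K : fieldType) (G : orderedGroupType)
    (v : valuation K G) (a c : K) : set K :=
  [set x | x = a \/ v c < v (x - a)].

Definition has_valuation_topology (K : topologicalFieldType)
    (G : orderedGroupType) (v : valuation K G) : Prop :=
  forall (a : K) (A : set K),
    nbhs a A <-> exists2 c : K, c != 0 & valuation_ball v a c `<=` A.

Definition valuation_ring_pred (K : fieldType) (G : orderedGroupType)
    (v : valuation K G) : {pred K} :=
  [pred x | (x == 0) || (0 <= v x)].

Lemma valuation1 (K : fieldType) (G : orderedGroupType) (v : valuation K G) :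
  v 1 = 0.
Proof.
by apply: (addrI (v 1)); rewrite -valuationM ?oner_neq0// mulr1 addr0.
Qed.

Lemma ordered_group_double_eq0 (G : orderedGroupType) (g : G) :
  g + g = 0 -> g = 0.
Proof.
move=> gg0; have /orP[g0|g0] := ordered_group_total 0 g; apply: le_anti;
  have := ordered_group_leD2r g _ _ g0; rewrite gg0 add0r => g0';
  by rewrite g0 g0'.
Qed.

Lemma valuationN (K : fieldType) (G : orderedGroupType) (v : valuation K G)
  (x : K) : x != 0 -> v (- x) = v x.
Proof.
have N1 : (-1 : K) != 0 by rewrite oppr_eq0 oner_neq0.
move=> x0; rewrite -mulN1r valuationM// (_ : v (-1) = 0) ?add0r//.
by apply: ordered_group_double_eq0; rewrite -valuationM// mulrNN mulr1 valuation1.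
Qed.

Lemma valuation_ring_subring (K : fieldType) (G : orderedGroupType)
  (v : valuation K G) : GRing.subring_closed (valuation_ring_pred v).
Proof.
split=> [|x y|x y]; rewrite !inE.
- by rewrite valuation1 lexx orbT.
- case: (eqVneq x 0) => [->|x0] /=; case: (eqVneq y 0) => [->|y0] /=.
  + by rewrite subr0 eqxx.
  + by rewrite sub0r valuationN// => _ ->; rewrite orbT.
  + by rewrite subr0 => -> _; rewrite orbT.
  + case: (eqVneq (x - y) 0) => //= xy0 vx vy.
    have Ny0 : - y != 0 by rewrite oppr_eq0.
    apply: le_trans (valuationD v x0 Ny0 xy0).
    by rewrite /Order.min valuationN//; case: ifP.
- case: (eqVneq x 0) => [->|x0] /=; first by rewrite mul0r eqxx.
  case: (eqVneq y 0) => [->|y0] /=; first by rewrite mulr0 eqxx.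
  move=> vx vy; rewrite valuationM// (le_trans vy) ?orbT//.
  by rewrite -[leLHS]add0r; apply: ordered_group_leD2r.
Qed.

HB.instance Definition _ (K : fieldType) (G : orderedGroupType)
    (v : valuation K G) :=
  GRing.isSubringClosed.Build K (valuation_ring_pred v)
    (valuation_ring_subring v).

Definition valuation_ring (K : fieldType) (G : orderedGroupType)
    (v : valuation K G) : Type :=
  {x : K | x \in valuation_ring_pred v}.

HB.instance Definition _ (K : fieldType) (G : orderedGroupType)
  (v : valuation K G) := SubChoice.on (valuation_ring v).
HB.instance Definition _ (K : fieldType) (G : orderedGroupType)
    (v : valuation K G) :=
  [SubChoice_isSubComNzRing of valuation_ring v by <:].

(** * Henselian local rings *)

Definition invertible (A : pzSemiRingType) (a : A) : Prop :=
  exists b : A, a * b = 1.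

Definition local_ring (A : comNzRingType) : Prop :=
  forall a b : A, ~ invertible a -> ~ invertible b -> ~ invertible (a + b).

(* A simple root in the residue field of a monic polynomial f lifts to A; an
   element of the residue field is given by a representative a0, and an element
   of A lies in the maximal ideal iff it is not invertible. *)
Definition henselian_local_ring (A : comNzRingType) : Prop :=
  local_ring A /\
  forall (f : {poly A}) (a0 : A), f \is monic ->
    ~ invertible f.[a0] -> invertible (f^`()).[a0] ->
    exists2 a : A, f.[a] = 0 & ~ invertible (a - a0).

(** * Schemes over a field *)

Record opens (X : topologicalType) := Opens {
  opens_set :> set X;
  opens_open : open opens_set
}.

(* A ringed space (X, O_X), O_X a sheaf of K-algebras with structure maps [cst].
   The rings of sections are not assumed to be nonzero, as O_X(set0) = 0. *)
Record ringedSpace (K : fieldType) := RingedSpace {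
  space :> topologicalType;
  sect : opens space -> comPzRingType;
  res : forall U V : opens space, V `<=` U -> {rmorphism sect U -> sect V};
  cst : forall U : opens space, {rmorphism K -> sect U};
  res_id : forall (U : opens space) (h : U `<=` U) (s : sect U), res h s = s;
  res_comp : forall (U V W : opens space)
    (hVU : V `<=` U) (hWV : W `<=` V) (hWU : W `<=` U) (s : sect U),
    res hWV (res hVU s) = res hWU s;
  res_cst : forall (U V : opens space) (h : V `<=` U) (c : K),
    res h (cst U c) = cst V c;
  sheaf_separated : forall (U : opens space) (C : set (opens space)),
    (forall V, C V -> V `<=` U) -> U `<=` \bigcup_(V in C) V ->
    forall s t : sect U,
    (forall (V : opens space) (h : V `<=` U), C V -> res h s = res h t) ->
    s = t;
  sheaf_glueing : forall (U : opens space) (C : set (opens space)),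
    (forall V, C V -> V `<=` U) -> U `<=` \bigcup_(V in C) V ->
    forall s : (forall V : opens space, sect V),
    (forall (V V' W : opens space) (h : W `<=` V) (h' : W `<=` V'),
      C V -> C V' -> res h (s V) = res h' (s V')) ->
    exists t : sect U,
      forall (V : opens space) (h : V `<=` U), C V -> res h t = s V
}.

(* The germ of f at x is invertible; this entails x \in U. *)
Definition invertible_at (K : fieldType) (X : ringedSpace K) (U : opens X)
    (f : sect U) (x : X) : Prop :=
  exists (V : opens X) (h : V `<=` U), opens_set V x /\ invertible (res h f).

Definition prime_ideal (A : comPzRingType) (P : set A) : Prop :=
  [/\ P 0, ~ P 1, (forall a b, P a -> P b -> P (a + b)),
      (forall a b, P b -> P (a * b)) &
      (forall a b, P (a * b) -> P a \/ P b)].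

(* f : A -> B presents B as the localization A[1/a] *)
Definition is_localization_away (A B : comPzRingType) (a : A)
    (f : {rmorphism A -> B}) : Prop :=
  [/\ invertible (f a),
      (forall b : B, exists (n : nat) (a' : A), b * f a ^+ n = f a') &
      (forall a' : A, f a' = 0 -> exists n : nat, a' * a ^+ n = 0)].

(* The canonical map from (U, O_X|U) to Spec O_X(U), which sends x to the prime
   ideal of the sections that are not invertible at x, is an isomorphism of
   locally ringed spaces: it is a well-defined bijection, a homeomorphism (the
   preimages of the D(f) form a basis of U), and on each D(f) the sections are
   the localization O_X(U)[1/f]. *)
Definition affine_open (K : fieldType) (X : ringedSpace K) (U : opens X) :
    Prop :=
  [/\ (forall x : X, opens_set U x ->
        prime_ideal [set f : sect U | ~ invertible_at f x]),
      (forall P : set (sect U), prime_ideal P ->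
        exists! x : X,
          opens_set U x /\ P = [set f : sect U | ~ invertible_at f x]),
      (forall (V : opens X) (x : X), V `<=` U -> opens_set V x ->
        exists f : sect U,
          invertible_at f x /\ [set y | invertible_at f y] `<=` V) &
      (forall (f : sect U) (V : opens X) (h : V `<=` U),
        opens_set V = [set y | invertible_at f y] ->
        is_localization_away f (res h))].

(* A K-scheme X -> Spec K, i.e. a scheme with a sheaf of K-algebras *)
Record kscheme (K : fieldType) := KScheme {
  ringed_space :> ringedSpace K;
  affine_cover : forall x : ringed_space,
    exists2 U : opens ringed_space, opens_set U x & affine_open U
}.

(* A morphism of K-schemes. The component O_Y(V) -> O_X(U) is given for every
   open U contained in the preimage of V, compatibly with restrictions. *)
Record kmorphism (K : fieldType) (X Y : kscheme K) := KMorphism {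
  mor_map :> X -> Y;
  mor_continuous : continuous mor_map;
  mor_sect : forall (V : opens Y) (U : opens X),
    U `<=` mor_map @^-1` V -> {rmorphism sect V -> sect U};
  mor_res : forall (V V' : opens Y) (U U' : opens X)
    (hV : V' `<=` V) (hU : U' `<=` U)
    (h : U `<=` mor_map @^-1` V) (h' : U' `<=` mor_map @^-1` V') (s : sect V),
    res hU (mor_sect h s) = mor_sect h' (res hV s);
  mor_cst : forall (V : opens Y) (U : opens X)
    (h : U `<=` mor_map @^-1` V) (c : K), mor_sect h (cst V c) = cst U c;
  mor_local : forall (V : opens Y) (U : opens X)
    (h : U `<=` mor_map @^-1` V) (s : sect V) (x : X),
    invertible_at (mor_sect h s) x -> invertible_at s (mor_map x)
}.

Definition mor_eq (K : fieldType) (X Y : kscheme K) (f g : kmorphism X Y) :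
    Prop :=
  (forall x, f x = g x) /\
  (forall (V : opens Y) (U : opens X)
     (hf : U `<=` f @^-1` V) (hg : U `<=` g @^-1` V) (s : sect V),
     mor_sect hf s = mor_sect hg s).

(* k = g \o f *)
Definition mor_is_comp (K : fieldType) (X Y Z : kscheme K)
    (f : kmorphism X Y) (g : kmorphism Y Z) (k : kmorphism X Z) : Prop :=
  (forall x, k x = g (f x)) /\
  (forall (W : opens Z) (V : opens Y) (U : opens X)
     (hf : U `<=` f @^-1` V) (hg : V `<=` g @^-1` W) (hk : U `<=` k @^-1` W)
     (s : sect W), mor_sect hk s = mor_sect hf (mor_sect hg s)).

Lemma mor_id_continuous (K : fieldType) (X : kscheme K) :
  continuous (id : X -> X).
Proof. by move=> x. Qed.

Lemma mor_id_res (K : fieldType) (X : kscheme K) (V V' U U' : opens X)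
  (hV : V' `<=` V) (hU : U' `<=` U) (h : U `<=` V) (h' : U' `<=` V')
  (s : sect V) : res hU (res h s) = res h' (res hV s).
Proof.
have k := subset_trans hU h.
by rewrite (res_comp h hU k) (res_comp hV h' k).
Qed.

Lemma mor_id_local (K : fieldType) (X : kscheme K) (V U : opens X)
  (h : U `<=` V) (s : sect V) (x : X) :
  invertible_at (res h s) x -> invertible_at s x.
Proof.
move=> [W [hW [Wx i]]]; have k := subset_trans hW h.
by exists W, k; split=> //; rewrite -(res_comp h hW k).
Qed.

Definition mor_id (K : fieldType) (X : kscheme K) : kmorphism X X :=
  @KMorphism K X X id (@mor_id_continuous K X)
    (fun V U (h : U `<=` V) => res h)
    (@mor_id_res K X) (fun V U h => res_cst h) (@mor_id_local K X).

(* p and q are the projections of a fibre product P = X x_K X *)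
Definition is_self_product (K : fieldType) (X P : kscheme K)
    (p q : kmorphism P X) : Prop :=
  forall (T : kscheme K) (f g : kmorphism T X),
    (exists h : kmorphism T P, mor_is_comp h p f /\ mor_is_comp h q g) /\
    (forall h h' : kmorphism T P,
       mor_is_comp h p f -> mor_is_comp h q g ->
       mor_is_comp h' p f -> mor_is_comp h' q g -> mor_eq h h').

(* The diagonal X -> X x_K X has closed image; being always an immersion, it is
   then a closed immersion. *)
Definition separated_kscheme (K : fieldType) (X : kscheme K) : Prop :=
  forall (P : kscheme K) (p q : kmorphism P X), is_self_product p q ->
  forall d : kmorphism X P,
    mor_is_comp d p (mor_id X) -> mor_is_comp d q (mor_id X) ->
    closed (range d).

(* The surjections of K-algebras K[x_1, .., x_n] -> O_X(W); for W affine, these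
   are the closed immersions of W in affine n-space. *)
Definition affine_embedding (K : fieldType) (X : kscheme K) (W : opens X)
    (n : nat) (phi : {rmorphism mpoly n K -> sect W}) : Prop :=
  (forall c : K, phi (mpolyC n c) = cst W c) /\
  (forall s : sect W, exists p : mpoly n K, phi p = s).

Definition finite_type (K : fieldType) (X : kscheme K) : Prop :=
  exists (m : nat) (W : 'I_m -> opens X),
    (forall x : X, exists i : 'I_m, opens_set (W i) x) /\
    (forall i : 'I_m, affine_open (W i) /\
       exists (n : nat) (phi : {rmorphism mpoly n K -> sect (W i)}),
         affine_embedding phi).

Definition kvariety (K : fieldType) (X : kscheme K) : Prop :=
  separated_kscheme X /\ finite_type X.

Definition irreducible_space (X : topologicalType) : Prop :=
  [set: X] !=set0 /\
  forall U V : set X, open U -> open V -> U !=set0 -> V !=set0 ->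
    U `&` V !=set0.

(* Locally X is Spec K[x_1, .., x_(c+d)] / (f_1, .., f_c) where the Jacobian
   determinant det (df_i / dx_j)_(i, j <= c) is an invertible function. *)
Definition smooth_at (K : fieldType) (X : kscheme K) (x : X) : Prop :=
  exists (W : opens X) (c d : nat)
    (phi : {rmorphism mpoly (c + d) K -> sect W})
    (f : 'I_c -> mpoly (c + d) K),
    [/\ opens_set W x, affine_open W, affine_embedding phi,
        (forall p : mpoly (c + d) K, phi p = 0 <->
           exists g : 'I_c -> mpoly (c + d) K, p = \sum_(i < c) g i * f i) &
        invertible
          (phi (\det (\matrix_(i < c, j < c) mderiv (lshift d j) (f i))))].

Definition smooth (K : fieldType) (X : kscheme K) : Prop :=
  forall x : X, smooth_at x.

(** * Rational points and the K-topology *)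

(* A K-morphism Spec K -> X: the image x of the unique point of Spec K, and a
   local homomorphism of K-algebras O_(X, x) -> K. *)
Record kpoint (K : fieldType) (X : kscheme K) := KPoint {
  kpt : X;
  kval : forall U : opens X, opens_set U kpt -> {rmorphism sect U -> K};
  kval_res : forall (U V : opens X) (h : V `<=` U) (hU : opens_set U kpt)
    (hV : opens_set V kpt) (s : sect U), kval hV (res h s) = kval hU s;
  kval_cst : forall (U : opens X) (hU : opens_set U kpt) (c : K),
    kval hU (cst U c) = c;
  kval_local : forall (U : opens X) (hU : opens_set U kpt) (s : sect U),
    kval hU s != 0 -> invertible_at s kpt
}.

HB.instance Definition _ (K : fieldType) (X : kscheme K) :=
  gen_eqMixin (kpoint X).
HB.instance Definition _ (K : fieldType) (X : kscheme K) :=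
  gen_choiceMixin (kpoint X).

(* U(K), as a subset of X(K) *)
Definition kpoints_in (K : fieldType) (X : kscheme K) (U : opens X) :
    set (kpoint X) :=
  [set x | opens_set U (kpt x)].

Definition kcoord (K : fieldType) (X : kscheme K) (W : opens X) (n : nat)
    (phi : {rmorphism mpoly n K -> sect W}) (x : kpoint X)
    (Wx : opens_set W (kpt x)) : 'rV[K]_n :=
  \row_(i < n) kval Wx (phi (mpolyX K (mnm1 i))).

(* S is open iff its trace on W(K) is open in the subspace topology from K^n, for
   every affine open W of X and every closed immersion of W in affine n-space. *)
Definition kopen (K : topologicalFieldType) (X : kscheme K) :
    set (set (kpoint X)) :=
  [set S | forall (W : opens X) (n : nat)
      (phi : {rmorphism mpoly n K -> sect W}),
      affine_open W -> affine_embedding phi ->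
      forall (x : kpoint X) (Wx : opens_set W (kpt x)), S x ->
      exists2 B : set 'rV[K]_n, nbhs (kcoord phi Wx) B &
        forall (y : kpoint X) (Wy : opens_set W (kpt y)),
          B (kcoord phi Wy) -> S y].

Lemma kopenT (K : topologicalFieldType) (X : kscheme K) : kopen [set: kpoint X].
Proof. by move=> W n phi _ _ x Wx _; exists setT => //; exact: filterT. Qed.

Lemma kopenI (K : topologicalFieldType) (X : kscheme K) :
  setI_closed (@kopen K X).
Proof.
move=> S S' oS oS' W n phi aW ephi x Wx [Sx S'x].
have [B nB sB] := oS _ _ _ aW ephi _ Wx Sx.
have [B' nB' sB'] := oS' _ _ _ aW ephi _ Wx S'x.
exists (B `&` B'); first exact: filterI.
by move=> y Wy [By B'y]; split; [exact: sB By|exact: sB' B'y].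
Qed.

Lemma kopen_bigU (K : topologicalFieldType) (X : kscheme K) (I : Type)
  (S : I -> set (kpoint X)) :
  (forall i, kopen (S i)) -> kopen (\bigcup_i S i).
Proof.
move=> oS W n phi aW ephi x Wx [i _ Six].
have [B nB sB] := oS i _ _ _ aW ephi _ Wx Six.
by exists B => // y Wy By; exists i => //; exact: sB By.
Qed.

HB.instance Definition _ (K : topologicalFieldType) (X : kscheme K) :=
  isOpenTopological.Build (kpoint X) (@kopenT K X) (@kopenI K X)
    (@kopen_bigU K X).

(** * The density property *)

Definition density_property (K : topologicalFieldType) : Prop :=
  forall X : kscheme K, kvariety X -> smooth X -> irreducible_space X ->
  forall U : opens X, opens_set U !=set0 -> dense (kpoints_in U).

(* Main.v *)
Require Import Defs.
From HB Require Import structures.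
From mathcomp Require Import all_boot all_order all_algebra.
From mathcomp Require Import boolp classical_sets topology tvs.
From mathcomp Require Import ring zify.

(** Let S be an open set of X(K) containing a point x, and let W be a chart
around x: a closed subscheme of affine space with coordinates x_1, .., x_c,
t_1, .., t_d, given by equations f_1, .., f_c whose Jacobian determinant in the
x_j is invertible. Since X is irreducible, W meets U, so some basic open subset
of W given by a function p lies in U, and p is not nilpotent. If a is the
coordinate vector of x, it suffices to find b in K^(c+d) close to a with
f(b) = 0 and p(b) <> 0 ([nearby_point]): evaluation at b is a morphism of
K-algebras O(W) -> K, and such a morphism is a rational point
([kpoint_of_algebra_morphism]).

Finding b is an implicit function theorem in several variables, whereas the
Henselian hypothesis lifts simple roots of polynomials in one variable, and in
arbitrary rank Newton's method need not converge. The two are reconciled as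
follows.

By irreducibility the radical of (f_1, .., f_c) is prime; let E be the quotient
domain. Each x_j satisfies in E a separable polynomial relation P_j over the
subring generated by the t_k and by x_1, .., x_(j-1), of minimal degree
([separable_relation_ex]). Otherwise E would carry a nonzero tangent vector on
which all dt_k vanish, which the Jacobian forbids. Let Z be the product of p, of
the leading coefficients of the P_j and of the derivatives P_j'(x_j). Taking
norms up the tower, Z divides in E some r(t) <> 0 ([multiple_in_base]).

Choose a line t = t(s) through t(a) on which r does not vanish identically. For
every m there is a polynomial curve xi over this line with xi(0) = a and
f(xi) = 0 modulo s^m, obtained by formal Newton iteration; as Z divides r(t),
the order rho of Z along xi is bounded independently of m ([generic_curve]).

Now take s in K close to 0 and correct the coordinates x_1, .., x_c of xi(s) one
after the other. The polynomial P_j, with coefficients evaluated at the point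
already corrected, vanishes to order m at xi_j(s) and its derivative there has
order at most rho; if m > 2 rho, Hensel's lemma gives a root at distance
O(s^(m - rho)) ([hensel_step]). As P_j is minimal, every relation that holds in
E between t, x_1, .., x_j then holds at the corrected point ([tower_step]). In
the end all the f_i vanish, and p does not, because the corrected point agrees
with xi(s) to an order larger than the order of p along xi. *)

Set Implicit Arguments.
Unset Strict Implicit.
Unset Printing Implicit Defensive.
Import Order.TTheory GRing.Theory.
Local Open Scope ring_scope.
Local Open Scope classical_set_scope.

(** * Minimal relations over a subring of a domain *)

Section MinimalPolynomial.
Variables (E : idomainType) (S : subringClosed E).

(** Division by P creates denominators that are powers of its leading
coefficient, so that quotient and remainder stay over S. *)
Lemma pseudo_division (P Q : {poly E}) : P != 0 ->
  P \is a polyOver S -> Q \is a polyOver S ->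
  exists (k : nat) (A T : {poly E}),
    [/\ A \is a polyOver S, T \is a polyOver S,
        lead_coef P ^+ k *: Q = A * P + T & (size T < size P)%N].
Proof.
move=> P0 PS; have [n] := ubnP (size Q); elim: n Q => // n IH Q lQn QS.
have [QP|PQ] := ltnP (size Q) (size P).
  by exists 0%N, 0, Q; rewrite rpred0 QS mul0r add0r expr0 scale1r.
have lP : lead_coef P \in S by apply: (polyOverP PS).
have lQ : lead_coef Q \in S by apply: (polyOverP QS).
set e := (size Q - size P)%N.
pose Q1 := lead_coef P *: Q - (lead_coef Q *: 'X^e) * P.
have sP : (0 < size P)%N by rewrite size_poly_gt0.
have Q1S : Q1 \is a polyOver S.
  by rewrite rpredB ?rpredM ?polyOverZ ?polyOverXn.
have sQ1 : (size Q1 < size Q)%N.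
  rewrite -[size Q]prednK ?(leq_trans sP)// ltnS.
  apply/leq_sizeP => j.
  rewrite leq_eqVlt /Q1 coefB coefZ -scalerAl coefZ coefXnM => /orP[/eqP <-|lj].
    rewrite ltnNge /e; have -> : (size Q - size P <= (size Q).-1)%N by lia.
    have -> : ((size Q).-1 - (size Q - size P) = (size P).-1)%N by lia.
    by rewrite /= /lead_coef mulrC subrr.
  have lQj : (size Q <= j)%N by lia.
  have -> /= : (j < e)%N = false by rewrite /e; lia.
  have lPj : (size P <= j - e)%N by rewrite /e; lia.
  by rewrite !nth_default ?mulr0 ?subr0.
have [k [A [T [AS TS eqn sT]]]] := IH Q1 (leq_trans sQ1 lQn) Q1S.
exists k.+1, (A + (lead_coef P ^+ k * lead_coef Q) *: 'X^e), T; split=> //.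
  by rewrite rpredD// polyOverZ ?polyOverXn// rpredM// rpredX.
move: eqn; rewrite /Q1 scalerBr scalerA -exprSr => /eqP.
rewrite subr_eq => /eqP ->.
rewrite mulrDl -!addrA; congr (_ + _); rewrite addrC; congr (_ + _).
by rewrite scalerAl scalerA.
Qed.

Definition minimal_relation (x : E) (P : {poly E}) : Prop :=
  [/\ P \is a polyOver S, P != 0, root P x &
      forall Q : {poly E}, Q \is a polyOver S -> root Q x ->
        (size Q < size P)%N -> Q = 0].

(** The pseudo-remainder of Q by P vanishes at x and has too small a degree. *)
Lemma minimal_relation_dvd (x : E) (P Q : {poly E}) :
  minimal_relation x P -> Q \is a polyOver S -> root Q x ->
  exists (k : nat) (A : {poly E}),
    A \is a polyOver S /\ lead_coef P ^+ k *: Q = A * P.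
Proof.
move=> [PS P0 Px Pmin] QS Qx.
have [k [A [T [AS TS eqn sT]]]] := pseudo_division P0 PS QS.
exists k, A; split=> //; rewrite eqn (Pmin T) ?addr0//.
move: eqn => /(congr1 (fun q => q.[x])).
by rewrite hornerD hornerZ hornerM (rootP Px) (rootP Qx) !mulr0 add0r /root => <-.
Qed.

Lemma minimal_relation_ex (x : E) (Q : {poly E}) :
  Q \is a polyOver S -> Q != 0 -> root Q x -> exists P, minimal_relation x P.
Proof.
have [n] := ubnP (size Q); elim: n Q => // n IH Q sQ QS Q0 Qx.
have [[T [TS T0 Tx sT]]|nT] := pselect (exists T : {poly E},
    [/\ T \is a polyOver S, T != 0, root T x & (size T < size Q)%N]).
  by apply: (IH T) => //; apply: leq_trans sT _.
exists Q; split=> // T TS Tx sT; apply: contra_notP nT => /eqP T0.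
by exists T.
Qed.

(** If P is minimal and P'(x) = 0, differentiating lead_coef P ^+ k *: Q = A * P
at x shows that every relation Q of x has a derivative vanishing at x; the same
holds trivially when x satisfies no relation at all. *)
Lemma minimal_relation_separable (x : E) :
  (forall Q : {poly E}, Q \is a polyOver S -> root Q x -> root Q^`() x) \/
  exists2 P, minimal_relation x P & ~~ root P^`() x.
Proof.
have [[P Pmin Px]|nP] :=
    pselect (exists2 P, minimal_relation x P & ~~ root P^`() x).
  by right; exists P.
left=> Q QS Qx; have [->|Q0] := eqVneq Q 0; first by rewrite deriv0 root0.
have [P Pmin] := minimal_relation_ex QS Q0 Qx.
have P'x : root P^`() x by apply: contra_notT nP => h; exists P.
have [k [A [_ eqn]]] := minimal_relation_dvd Pmin QS Qx.
have [_ P0 Px _] := Pmin.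
move: eqn => /(congr1 (fun q => (q^`()).[x])) /eqP.
rewrite derivZ derivM hornerZ hornerD !hornerM (rootP Px) (rootP P'x) !mulr0.
by rewrite addr0 mulf_eq0 expf_eq0 lead_coef_eq0 (negPf P0) andbF.
Qed.

(** A substitute for the norm of Q.[x]: in the Euclidean algorithm between P
and Q all remainders have values at x that are multiples of Q.[x], and by
minimality of P the algorithm can only stop at a nonzero constant. *)
Lemma minimal_relation_multiple (x : E) (P Q : {poly E}) :
  minimal_relation x P -> Q \is a polyOver S -> ~~ root Q x ->
  exists (r : E) (W : {poly E}),
    [/\ r \in S, r != 0, W \is a polyOver S & Q.[x] * W.[x] = r].
Proof.
move=> [PS P0 Px Pmin] QS Qx.
suff: forall n (T W : {poly E}), (size T < n)%N -> T \is a polyOver S ->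
    W \is a polyOver S ->
    ~~ root T x -> T.[x] = Q.[x] * W.[x] ->
    exists (r : E) (W : {poly E}),
    [/\ r \in S, r != 0, W \is a polyOver S & Q.[x] * W.[x] = r].
  by move=> /(_ (size Q).+1 Q 1); apply=> //; rewrite ?rpred1// hornerC mulr1.
elim=> // n IH T W sT TS WS Tx eqT.
have T0 : T != 0 by apply: contraNneq Tx => ->; rewrite root0.
have [sPT|sTP] := leqP (size P) (size T).
  have [k [A [U [AS US eqn sU]]]] := pseudo_division P0 PS TS.
  have eqU : U.[x] = lead_coef P ^+ k * T.[x].
    move: eqn => /(congr1 (fun q => q.[x])).
    by rewrite hornerD hornerZ hornerM (rootP Px) !mulr0 add0r => <-.
  apply: (IH U (lead_coef P ^+ k *: W)) => //.
  - by rewrite -ltnS; apply: leq_trans sT; rewrite ltnS; apply: leq_trans sPT.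
  - by rewrite polyOverZ// rpredX// (polyOverP PS).
  - by rewrite /root eqU mulf_neq0 ?expf_neq0 ?lead_coef_eq0//.
  - by rewrite eqU eqT hornerZ; ring.
have [sT1|sT1] := leqP (size T) 1.
  exists T.[x], W; split=> //.
    by rewrite (size1_polyC sT1) hornerC (polyOverP TS).
(* T now has degree between 1 and deg P - 1: continue with P modulo T. *)
have [k [A [U [AS US eqn sU]]]] := pseudo_division T0 TS PS.
have eqU : U.[x] = - A.[x] * T.[x].
  move: eqn => /(congr1 (fun q => q.[x])).
  rewrite hornerD hornerZ hornerM (rootP Px) !mulr0 => /esym/eqP.
  by rewrite addrC addr_eq0 mulNr => /eqP.
have [Ux|Ux] := boolP (root U x); last first.
  apply: (IH U (- A * W)) => //.
    by rewrite -ltnS; apply: leq_trans sT; rewrite ltnS.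
    by rewrite rpredM// rpredN.
  by rewrite eqU eqT hornerM hornerN; ring.
have U0 : U = 0 by apply: Pmin => //; apply: ltn_trans sU sTP.
have Ax : root A x.
  move: Ux; rewrite /root eqU mulf_eq0 oppr_eq0 => /orP[//|].
  by move=> Tx'; move: Tx; rewrite /root Tx'.
have lT : lead_coef T ^+ k != 0 by rewrite expf_neq0 ?lead_coef_eq0.
have AT0 : A * T != 0.
  by move: eqn; rewrite U0 addr0 => <-; rewrite -mul_polyC mulf_neq0 ?polyC_eq0.
have A0 : A != 0 by apply: contraNneq AT0 => ->; rewrite mul0r.
have: A = 0.
  apply: Pmin => //; rewrite -(size_scale P lT) eqn U0 addr0 size_mul//.
  by case: (size T) sT1 => [|[|m]] // _; rewrite !addnS /= ltnS leq_addr.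
by move/eqP; rewrite (negPf A0).
Qed.

End MinimalPolynomial.

(** * Polynomials in some of the variables, and derivations *)

Definition mvar (K : fieldType) n (i : 'I_n) : mpoly n K := mpolyX K (mnm1 i).
Arguments mvar {K n} i.

Section GeneratedSubring.
Variables (K : fieldType) (n : nat).
Local Notation R := (mpoly n K).

(** The K-subalgebra generated by the variables in V, presented inductively so
that statements about it, and about all polynomials, are proved by induction on
ring operations. *)
Inductive gen_by (V : pred 'I_n) : R -> Prop :=
| gen_by_const a : gen_by V (mpolyC n a)
| gen_by_var i : V i -> gen_by V (mvar i)
| gen_byD p q : gen_by V p -> gen_by V q -> gen_by V (p + q)
| gen_byM p q : gen_by V p -> gen_by V q -> gen_by V (p * q).

Definition gen (V : pred 'I_n) : {pred R} := fun p => `[< gen_by V p >].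

Lemma genP V p : reflect (gen_by V p) (p \in gen V).
Proof. exact: asboolP. Qed.

Lemma gen_subring V : GRing.subring_closed (gen V).
Proof.
split=> [|p q /genP gp /genP gq|p q /genP gp /genP gq]; apply/genP.
- by rewrite -(mpolyC1 n K); exact: gen_by_const.
- apply: gen_byD => //; rewrite -mulN1r -(mpolyC1 n K) -mpolyCN.
  by apply: gen_byM => //; exact: gen_by_const.
- exact: gen_byM.
Qed.

HB.instance Definition _ V :=
  GRing.isSubringClosed.Build R (gen V) (gen_subring V).

Lemma gen_all (p : R) : gen_by predT p.
Proof.
apply/genP; rewrite -[p]/(idfun p) [p]mpolyE; apply: rpred_sum => m _.
rewrite -mul_mpolyC; apply: rpredM; first exact/genP/gen_by_const.
rewrite mpolyXE_id; apply: rpred_prod => i _; apply: rpredX.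
exact/genP/gen_by_var.
Qed.

Lemma mpoly_ind_ring (P : R -> Prop) :
  (forall a, P (mpolyC n a)) -> (forall i, P (mvar i)) ->
  (forall p q, P p -> P q -> P (p + q)) ->
  (forall p q, P p -> P q -> P (p * q)) -> forall p, P p.
Proof. by move=> PC PX PD PM p; elim: (gen_all p) => *; auto. Qed.

Lemma genS (V V' : pred 'I_n) p : (forall i, V i -> V' i) -> p \in gen V -> p \in gen V'.
Proof.
move=> sV /genP gp; apply/genP; elim: gp => *.
- exact: gen_by_const.
- by apply: gen_by_var; apply: sV.
- exact: gen_byD.
- exact: gen_byM.
Qed.

Lemma gen_mderiv (V : pred 'I_n) p i : p \in gen V -> ~~ V i -> mderiv i p = 0.
Proof.
move=> /genP gp Vi; elim: gp => [a|j Vj|q r _ IHq _ IHr|q r _ IHq _ IHr].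
- exact: mderivC.
- rewrite mderivX mnm1E; have [eji|_] := eqVneq j i; last by rewrite scale0r.
  by move: Vi; rewrite -eji Vj.
- by rewrite mderivD IHq IHr addr0.
- by rewrite mderivM IHq IHr mul0r mulr0 addr0.
Qed.

Lemma mderiv_mvar (i j : 'I_n) : mderiv i (mvar j : R) = (i == j)%:R.
Proof.
rewrite mderivX mnm1E eq_sym; have [->|_] := eqVneq i j; last by rewrite scale0r.
have -> : mnm_sub (mnm1 j) (mnm1 j) = @mnm0 n by apply/mnmP => k; rewrite mnmBE subnn mnm0E.
by rewrite mpolyX0 scale1r.
Qed.

Lemma gen_horner (V V' : pred 'I_n) x p : (forall i, V' i -> V i \/ i = x) ->
  p \in gen V' -> exists2 Q, Q \is a polyOver (gen V) & p = Q.[mvar x].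
Proof.
move=> sV /genP; elim=> [a|i /sV[Vi|->]|q r _ [Q QV ->] _ [T TV ->]
                        |q r _ [Q QV ->] _ [T TV ->]].
- exists (mpolyC n a)%:P; rewrite ?hornerC// polyOverC.
  exact/genP/gen_by_const.
- by exists (mvar i)%:P; rewrite ?hornerC// polyOverC; exact/genP/gen_by_var.
- by exists 'X; rewrite ?hornerX// polyOverX.
- by exists (Q + T); rewrite ?hornerD// rpredD.
- by exists (Q * T); rewrite ?hornerM// rpredM.
Qed.

Section Image.
Variables (E : idomainType) (pi : {rmorphism R -> E}).

Definition gen_image (V : pred 'I_n) : {pred E} :=
  fun e => `[< exists2 p, p \in gen V & pi p = e >].

Lemma gen_image_subring V : GRing.subring_closed (gen_image V).
Proof.
split=> [|x y /asboolP[p gp <-] /asboolP[q gq <-]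
         |x y /asboolP[p gp <-] /asboolP[q gq <-]]; apply/asboolP.
- by exists 1; rewrite ?rmorph1// rpred1.
- by exists (p - q); rewrite ?rmorphB// rpredB.
- by exists (p * q); rewrite ?rmorphM// rpredM.
Qed.

HB.instance Definition _ V :=
  GRing.isSubringClosed.Build E (gen_image V) (gen_image_subring V).

Lemma map_poly_gen_image V (Q : {poly R}) :
  Q \is a polyOver (gen V) -> map_poly pi Q \is a polyOver (gen_image V).
Proof.
move=> /polyOverP QV; apply/polyOverP => i; rewrite coef_map.
by apply/asboolP; exists Q`_i.
Qed.

Lemma gen_image_lift V (Q : {poly E}) : Q \is a polyOver (gen_image V) ->
  exists2 Q', Q' \is a polyOver (gen V) & map_poly pi Q' = Q.
Proof.
move=> /polyOverP QV.
have /choice[h hP] : forall i, exists p, p \in gen V /\ pi p = Q`_i.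
  by move=> i; have /asboolP[p gp e] := QV i; exists p.
exists (\poly_(i < size Q) h i).
  apply/polyOverP => i; rewrite coef_poly; case: ifP => _; last exact: rpred0.
  by have [] := hP i.
apply/polyP => i; rewrite coef_map coef_poly.
case: ltnP => [_|le]; first by have [] := hP i.
by rewrite raddf0 nth_default.
Qed.

(** The K-derivation R -> E over pi with prescribed values del on the variables,
that is, a tangent vector del read as an operator. *)
Definition derivation (del : 'I_n -> E) (p : R) : E :=
  \sum_i pi (mderiv i p) * del i.

Variable del : 'I_n -> E.
Local Notation D := (derivation del).

Lemma derivation_zmod : zmod_morphism D.
Proof.
move=> p q; rewrite /derivation -sumrB; apply: eq_bigr => i _.
by rewrite mderivB rmorphB mulrBl.
Qed.

HB.instance Definition _ := GRing.isZmodMorphism.Build R E D derivation_zmod.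

Lemma derivationM p q : D (p * q) = D p * pi q + pi p * D q.
Proof.
rewrite /derivation mulr_sumr mulr_suml -big_split; apply: eq_bigr => i _ /=.
by rewrite mderivM rmorphD !rmorphM; ring.
Qed.

Lemma derivation_mvar i : D (mvar i) = del i.
Proof.
rewrite /derivation (bigD1 i)//= mderiv_mvar eqxx rmorph1 mul1r big1 ?addr0// => j ji.
by rewrite mderiv_mvar (negPf ji) rmorph0 mul0r.
Qed.

Lemma derivation_horner (Q : {poly R}) y :
  D Q.[y] = (map_poly D Q).[pi y] + pi Q^`().[y] * D y.
Proof.
elim/poly_ind: Q => [|Q a IH].
  by rewrite deriv0 map_poly0 !horner0 !raddf0 mul0r addr0.
rewrite hornerMXaddC derivD derivM derivX derivC addr0 mulr1 raddfD /= derivationM.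
have -> : map_poly D (Q * 'X + a%:P) = map_poly D Q * 'X + (D a)%:P.
  apply/polyP => i; rewrite coefD coefMX coefC !coef_map_id0 ?raddf0// coefD coefMX coefC.
  by case: i => [|i] //=; rewrite ?addr0 ?coef_map_id0 ?raddf0// !add0r.
rewrite IH hornerMXaddC hornerD hornerMX rmorphD rmorphM /=; ring.
Qed.

End Image.
End GeneratedSubring.

(** * An etale algebra as a tower of separable extensions *)

Section EtaleTower.
Variables (K : fieldType) (c d : nat).
Local Notation R := (mpoly (c + d) K).
Variables (E : idomainType) (pi : {rmorphism R -> E}).

(** The variables of the j-th step of the tower: the last d coordinates, which
form the base, and the first j of the others. *)
Definition stage (j : nat) : pred 'I_(c + d) :=
  fun i => ((i < j) || (c <= i))%N.

Lemma stageS (j : 'I_c) i : stage j.+1 i -> stage j i \/ i = lshift d j.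
Proof.
rewrite /stage ltnS leq_eqVlt -orbA => /orP[/eqP e|]; last by left.
by right; apply: val_inj.
Qed.

Lemma stage_notin (j : 'I_c) i : (j <= i)%N -> ~~ stage i (lshift d j) = (j == i :> nat).
Proof. by move=> ji; rewrite /stage /= negb_or -!ltnNge ltn_ord andbT ltnS eqn_leq ji. Qed.

Lemma stage_self (j : 'I_c) : ~~ stage j (lshift d j).
Proof. by rewrite stage_notin. Qed.

Definition image_var j := pi (mvar (lshift d j)).

Definition separable_relation (j : 'I_c) (P : {poly E}) : Prop :=
  minimal_relation (gen_image pi (stage j)) (image_var j) P /\
  ~~ root P^`() (image_var j).

Lemma horner_map_mvar (Q : {poly R}) (i : 'I_(c + d)) :
  (map_poly pi Q).[pi (mvar i)] = pi Q.[mvar i].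
Proof. exact: horner_map. Qed.

(** del is a vector with zero components on the base and on the coordinates from
l on, tangent to the image of the variables of stage l. *)
Definition tangent (l : nat) (del : 'I_(c + d) -> E) : Prop :=
  (forall i, stage 0 i || (l <= i)%N -> del i = 0) /\
  (forall p, p \in gen (stage l) -> pi p = 0 -> derivation pi del p = 0).

Lemma derivation_stage l del p :
  (forall i, stage l i -> del i = 0) -> p \in gen (stage l) -> derivation pi del p = 0.
Proof.
move=> del0 gp; rewrite /derivation big1// => i _.
have [Vi|Vi] := boolP (stage l i); first by rewrite del0 ?mulr0.
by rewrite (gen_mderiv gp Vi) raddf0 mul0r.
Qed.

(** If derivatives of relations of x_j are again relations, then d/dx_j is well
defined on the j+1st step of the tower. *)
Lemma tangent_start (j : 'I_c) :
  (forall Q : {poly E}, Q \is a polyOver (gen_image pi (stage j)) ->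
     root Q (image_var j) -> root Q^`() (image_var j)) ->
  tangent j.+1 (fun i => (i == lshift d j)%:R).
Proof.
move=> bad; split=> [i|p gp p0].
  case: eqVneq => [->|//]; rewrite /stage/= ltnn orbF.
  by rewrite leqNgt ltn_ord.
have [Q QV ep] := gen_horner (@stageS j) gp.
rewrite ep derivation_horner derivation_mvar eqxx mulr1.
have -> : map_poly (derivation pi (fun i => (i == lshift d j)%:R)) Q = 0.
  apply/polyP => i; rewrite coef_map_id0 ?raddf0// coef0.
  apply: (derivation_stage (l := j)); last exact: (polyOverP QV).
  by move=> k; case: eqVneq => // ->; rewrite (negPf (stage_self j)).
rewrite horner0 add0r -horner_map_mvar -deriv_map; apply/rootP.
apply: bad; first exact: map_poly_gen_image.
by rewrite /root horner_map_mvar -ep p0.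
Qed.

(** A derivation extends along a separable relation P by the usual formula
D(x) = - P^D(x) / P'(x), where D acts on the coefficients in P^D. To remain in E
the whole derivation is multiplied by P'(x). The extension kills every relation
p = Q(x), since a power of lead_coef P times Q is a multiple of P. *)
Lemma tangent_step (l : 'I_c) del (P : {poly E}) :
  separable_relation l P -> tangent l del ->
  exists e : E, exists2 del' : 'I_(c + d) -> E, e != 0 &
    tangent l.+1 del' /\ forall i : 'I_(c + d), (i < l)%N -> del' i = e * del i.
Proof.
move=> [Pmin Psep] [del0 delV].
have [PS P0 Px _] := Pmin.
have [P' P'V eP] := gen_image_lift PS.
set x := image_var l in Px Psep Pmin.
exists P^`().[x].
pose y := (map_poly (derivation pi del) P').[x].
exists (fun i => P^`().[x] * del i - (i == lshift d l)%:R * y); first exact: Psep.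
set del' := fun i => _.
have del'l : del' (lshift d l) = - y.
  by rewrite /del' eqxx mul1r del0 ?leqnn ?orbT// mulr0 sub0r.
have del'E p : p \in gen (stage l) ->
    derivation pi del' p = P^`().[x] * derivation pi del p.
  move=> gp; rewrite /derivation mulr_sumr; apply: eq_bigr => i _; rewrite /del'.
  case: eqVneq => [->|_]; last by rewrite mul0r subr0; ring.
  by rewrite (gen_mderiv gp (stage_self l)) raddf0 !mul0r mulr0.
have del'P : derivation pi del' P'.[mvar (lshift d l)] = 0.
  rewrite derivation_horner derivation_mvar del'l -horner_map_mvar -deriv_map eP.
  have -> : map_poly (derivation pi del') P' =
      P^`().[x] *: map_poly (derivation pi del) P'.
    apply/polyP => i; rewrite coefZ !coef_map_id0 ?raddf0// del'E//.
    exact: (polyOverP P'V).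
  by rewrite hornerZ -/x -/y mulrN subrr.
split; last first.
  move=> i il; rewrite /del'; case: eqVneq => [e|_]; last by rewrite mul0r subr0.
  by move: il; rewrite e /= ltnn.
split=> [i|p gp p0].
  rewrite /del'; case: eqVneq => [->|il].
    by rewrite /stage /= ltnn orbF leqNgt ltn_ord.
  move=> h; rewrite del0 ?mulr0 ?mul0r ?subrr//.
  by move: h => /orP[->//|/ltnW ->]; rewrite orbT.
have [Q QV ep] := gen_horner (@stageS l) gp.
have Qx : root (map_poly pi Q) x by rewrite /root horner_map_mvar -ep p0.
have [k [A [AS eqn]]] := minimal_relation_dvd Pmin (map_poly_gen_image pi QV) Qx.
have [A' A'V eA] := gen_image_lift AS.
pose lam := P'`_(size P).-1.
have lamV : lam \in gen (stage l) by apply: (polyOverP P'V).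
have elam : pi lam = lead_coef P by rewrite /lam -coef_map eP.
pose h := lam ^+ k *: Q - A' * P'.
have hV : h \is a polyOver (gen (stage l)).
  by rewrite rpredB ?rpredM// polyOverZ// rpredX.
have h0 : map_poly pi h = 0.
  by rewrite rmorphB /= map_polyZ rmorphM rmorphXn /= elam eA eP eqn subrr.
have Dh : derivation pi del' h.[mvar (lshift d l)] = 0.
  rewrite derivation_horner -horner_map_mvar -deriv_map h0 deriv0 horner0 mul0r addr0.
  have -> : map_poly (derivation pi del') h = 0; last by rewrite horner0.
  apply/polyP => i; rewrite coef_map_id0 ?raddf0// coef0 del'E ?(polyOverP hV)//.
  rewrite delV ?mulr0 ?(polyOverP hV)//.
  by rewrite -coef_map h0 coef0.
move: Dh; rewrite /h hornerD hornerN hornerZ hornerM -ep raddfB /= !derivationM p0.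
rewrite del'P !mulr0 addr0 add0r rmorphXn /= elam.
rewrite -horner_map_mvar eP (rootP Px) mulr0 subr0 => /eqP.
by rewrite mulf_eq0 expf_eq0 lead_coef_eq0 (negPf P0) andbF => /eqP.
Qed.

Variable f : 'I_c -> R.

Definition jacobian := \matrix_(i < c, j < c) mderiv (lshift d j) (f i).

Lemma stage_all (p : R) : p \in gen (stage c).
Proof.
apply: genS (introT (genP _ _) (gen_all p)) => i _.
by rewrite /stage ltnNge orNb.
Qed.

(** If some stage had no separable relation, start a tangent vector at the last
such stage and extend it to the top. It is nonzero and is killed by the Jacobian
matrix, whose determinant is not zero. *)
Theorem separable_relation_ex : (forall i, pi (f i) = 0) ->
  pi (\det jacobian) != 0 -> forall j, exists P, separable_relation j P.
Proof.
move=> f0 J0.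
suff tan0 del : tangent c del -> forall j, del (lshift d j) = 0.
  have [//|/existsNP[j nj]] := pselect (forall j, exists P, separable_relation j P).
  pose bad (i : 'I_c) := `[< ~ exists P, separable_relation i P >].
  have badj : bad j by apply/asboolP.
  have [j0 /asboolP nj0 maxj0] := arg_maxnP (fun i : 'I_c => val i) badj.
  have := minimal_relation_separable (gen_image pi (stage j0)) (image_var j0).
  case=> [bj0|[P *]]; last by case: nj0; exists P.
  suff [del [tdel []]] : exists del, tangent c del /\ del (lshift d j0) <> 0.
    exact: tan0.
  have: forall l, (j0 < l <= c)%N -> exists del, tangent l del /\ del (lshift d j0) <> 0.
    elim=> // l IH /andP[]; rewrite ltnS leq_eqVlt => /orP[/eqP <- _|jl lc].
      exists (fun i => (i == lshift d j0)%:R); split; first exact: tangent_start.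
      by rewrite eqxx; apply/eqP; rewrite oner_eq0.
    have [del [tdel delj]] := IH (introT andP (conj jl (ltnW lc))).
    have [P sP] : exists P, separable_relation (Ordinal lc) P.
      apply: contrapT => nP; have := maxj0 (Ordinal lc) (introT (asboolP _) nP).
      by rewrite /= leqNgt jl.
    have [e [del' e0 [tdel' del'E]]] := tangent_step sP tdel.
    exists del'; split=> //; rewrite del'E//; apply/eqP; rewrite mulf_neq0//.
    exact/eqP.
  by apply; rewrite ltn_ord leqnn.
move=> [del0 delV] j.
pose J := map_mx pi jacobian.
pose u : 'cV[E]_c := \col_j del (lshift d j).
have Ju : J *m u = 0.
  apply/matrixP => i k; rewrite !mxE -[RHS](delV (f i) (stage_all _) (f0 i)).
  rewrite /derivation big_split_ord /= [X in _ = _ + X]big1 ?addr0 => [|s _].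
    by apply: eq_bigr => s _; rewrite !mxE.
  by rewrite del0 ?mulr0// /stage /= leq_addr orbT.
have: \adj J *m J *m u = 0 by rewrite -mulmxA Ju mulmx0.
rewrite mul_adj_mx mul_scalar_mx => /matrixP /(_ j 0); rewrite !mxE => /eqP.
by rewrite det_map_mx mulf_eq0 (negPf J0) => /eqP.
Qed.

(** Descend one stage at a time, replacing an element by a nonzero multiple. *)
Theorem multiple_in_base : (forall j, exists P, separable_relation j P) ->
  forall p : R, pi p != 0 -> exists r w : R,
    [/\ r \in gen (stage 0), pi r != 0 & pi (p * w) = pi r].
Proof.
move=> sep; suff: forall l, (l <= c)%N -> forall p : R, p \in gen (stage l) ->
    pi p != 0 -> exists r w : R,
      [/\ r \in gen (stage 0), pi r != 0 & pi (p * w) = pi r].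
  by move=> /(_ c (leqnn c)) h p; apply: h; exact: stage_all.
elim=> [_ p gp p0|l IH lc p gp p0]; first by exists p, 1; rewrite mulr1.
have [Q QV ep] := gen_horner (@stageS (Ordinal lc)) gp.
have [P [Pmin _]] := sep (Ordinal lc).
have Qx : ~~ root (map_poly pi Q) (image_var (Ordinal lc)).
  by rewrite /root horner_map_mvar -ep.
have [r [W [/asboolP[r' gr <-] r0 WS e]]] :=
  minimal_relation_multiple Pmin (map_poly_gen_image pi QV) Qx.
have [W' W'V eW] := gen_image_lift WS.
have [s [w [gs s0 e']]] := IH (ltnW lc) _ gr r0.
exists s, (W'.[mvar (lshift d (Ordinal lc))] * w); split=> //.
rewrite -e' mulrA rmorphM [RHS]rmorphM /= -e; congr (_ * _).
by rewrite rmorphM /= ep -!horner_map_mvar eW.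
Qed.

End EtaleTower.

(** * Approximate curves *)

Section Evaluation.
Variables (K : fieldType) (n : nat).
Local Notation R := (mpoly n K).

Lemma meval_mvar (u : 'I_n -> K) i : meval u (mvar i) = u i.
Proof. exact: mevalXU. Qed.

(** Composition of a polynomial with a polynomial curve. *)
Definition along (xi : 'I_n -> {poly K}) : R -> {poly K} := mmap (@polyC K) xi.

HB.instance Definition _ xi := GRing.RMorphism.copy (along xi) (mmap (@polyC K) xi).

Lemma along_const xi a : along xi (mpolyC n a) = a%:P.
Proof. exact: mmapC. Qed.

Lemma along_mvar xi i : along xi (mvar i) = xi i.
Proof. by rewrite /along /mvar mmapX mmap1U. Qed.

Lemma horner_along xi p s : (along xi p).[s] = meval (fun i => (xi i).[s]) p.
Proof.
elim/mpoly_ind_ring: p => [a|i|p q IHp IHq|p q IHp IHq].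
- by rewrite along_const hornerC mevalC.
- by rewrite along_mvar meval_mvar.
- by rewrite rmorphD /= hornerD IHp IHq mevalD.
- by rewrite rmorphM /= hornerM IHp IHq mevalM.
Qed.

Lemma gen_meval (V : pred 'I_n) (u u' : 'I_n -> K) p :
  (forall i, V i -> u i = u' i) -> p \in gen V -> meval u p = meval u' p.
Proof.
move=> uu' /genP; elim=> [a|i Vi|q r _ IHq _ IHr|q r _ IHq _ IHr].
- by rewrite !mevalC.
- by rewrite !meval_mvar uu'.
- by rewrite !mevalD IHq IHr.
- by rewrite !mevalM IHq IHr.
Qed.

Lemma gen_along (V : pred 'I_n) (u u' : 'I_n -> {poly K}) p :
  (forall i, V i -> u i = u' i) -> p \in gen V -> along u p = along u' p.
Proof.
move=> uu' /genP; elim=> [a|i Vi|q r _ IHq _ IHr|q r _ IHq _ IHr].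
- by rewrite !along_const.
- by rewrite !along_mvar uu'.
- by rewrite !rmorphD /= IHq IHr.
- by rewrite !rmorphM /= IHq IHr.
Qed.

(** Induction on the number of variables: specialize first the leading
coefficient with respect to one variable, then avoid finitely many roots. *)
Lemma meval_neq0 : (forall q : {poly K}, q != 0 -> exists x, q.[x] != 0) ->
  forall p : R, p != 0 -> exists u : 'I_n -> K, meval u p != 0.
Proof.
move=> infK; suff: forall j, (j <= n)%N -> forall p : R,
    p \in gen (fun i : 'I_n => (i < j)%N) -> p != 0 -> exists u : 'I_n -> K, meval u p != 0.
  move=> /(_ n (leqnn n)) h p; apply: h.
  by apply: genS (introT (genP _ _) (gen_all p)) => i _.
elim=> [_ p gp|j IH jn p gp] p0.
  suff [a ep] : exists a, p = mpolyC n a.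
    by exists (fun=> 0); rewrite ep mevalC; move: p0; rewrite ep mpolyC_eq0.
  move/genP: gp => {p0}; elim=> [a|//|q r _ [a ->] _ [b ->]|q r _ [a ->] _ [b ->]].
  - by exists a.
  - by exists (a + b); rewrite mpolyCD.
  - by exists (a * b); rewrite mpolyCM.
pose i := Ordinal jn.
have [|Q QV ep] := @gen_horner K n (fun i => i < j)%N _ i p _ gp.
  move=> k; rewrite ltnS leq_eqVlt => /orP[/eqP e|]; last by left.
  by right; apply: val_inj.
have Q0 : Q != 0 by apply: contraNneq p0 => Q0; rewrite ep Q0 horner0.
have [u lu] := IH (ltnW jn) (lead_coef Q) (polyOverP QV _)
  (etrans (congr1 negb (lead_coef_eq0 Q)) Q0).
have [|x Qx] := infK (map_poly (meval u) Q).
  apply: contraNneq lu => /(congr1 (fun q : {poly K} => q`_(size Q).-1)).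
  by rewrite coef_map coef0 => <-.
pose u' k := if k == i then x else u k.
exists u'; suff -> : meval u' p = (map_poly (meval u) Q).[x] by [].
rewrite ep -(horner_map (meval u')) /= meval_mvar /u' eqxx; congr _.[_].
apply/polyP => k; rewrite !coef_map; apply: gen_meval (polyOverP QV k) => s sj.
by case: eqVneq sj => // ->; rewrite ltnn.
Qed.

(** First-order Taylor expansion; the exponent M.+1 is positive so that the
quadratic terms are divisible by 'X^(M.+2). *)
Lemma along_taylor (xi eta : 'I_n -> {poly K}) (M : nat) (p : R) :
  exists q, along (fun i => xi i + 'X^(M.+1) * eta i) p =
    along xi p + 'X^(M.+1) * derivation (along xi) eta p + 'X^(M.+2) * q.
Proof.
pose xi' i := xi i + 'X^(M.+1) * eta i; rewrite -/xi'.
elim/mpoly_ind_ring: p => [a|i|p q [u eu] [w ew]|p q [u eu] [w ew]].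
- exists 0; rewrite /derivation big1 ?mulr0 ?addr0 ?along_const// => i _.
  by rewrite mderivC raddf0 mul0r.
- by exists 0; rewrite derivation_mvar !along_mvar mulr0 addr0.
- by exists (u + w); rewrite !rmorphD /= raddfD /= eu ew; ring.
- set dp := derivation _ _ p in eu; set dq := derivation _ _ q in ew.
  exists (along xi p * w + u * along xi q + 'X^M * (dp + 'X * u) * (dq + 'X * w)).
  rewrite !rmorphM derivationM /= eu ew -/dp -/dq !exprS; ring.
Qed.

End Evaluation.

Section Curves.
Variables (K : fieldType) (c d : nat).
Local Notation R := (mpoly (c + d) K).
Variables (f : 'I_c -> R) (a : 'I_(c + d) -> K).
Hypothesis fa : forall i, meval a (f i) = 0.
Hypothesis Ja : meval a (\det (jacobian f)) != 0.

(** Formal Newton iteration with the fixed invertible matrix J(a): changing xi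
by 'X^M.+1 * y for a constant vector y changes the leading term of f(xi) by
J(a) y. The base coordinates th are prescribed. *)
Lemma approximate_curve (th : 'I_d -> {poly K}) M :
  (forall k, (th k).[0] = a (rshift c k)) ->
  exists xi : 'I_(c + d) -> {poly K},
    [/\ forall k, xi (rshift c k) = th k, forall i, (xi i).[0] = a i &
        forall i, 'X^M %| along xi (f i)].
Proof.
move=> th0; suff: exists xi : 'I_(c + d) -> {poly K},
    [/\ forall k, xi (rshift c k) = th k, forall i, (xi i).[0] = a i &
        forall i, 'X^(M.+1) %| along xi (f i)].
  move=> [xi [h1 h2 h3]]; exists xi; split=> // i; apply: dvdp_trans (h3 i).
  by rewrite dvdp_exp2l.
elim: M => [|M [xi [xit xi0 xif]]].
  exists (fun i => match split i with inl _ => (a i)%:P | inr k => th k end).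
  have h i : (match split i with inl _ => (a i)%:P | inr k => th k end).[0] = a i.
    by case: split_ordP => [j ->|k ->]; rewrite ?hornerC.
  split=> // [k|i]; first by case: split_ordP => [j /eqP|j /rshift_inj ->//];
    rewrite eq_rlshift.
  rewrite expr1 -['X]subr0 dvdp_XsubCl /root horner_along.
  by rewrite (meval_eq _ h) fa.
have /choice[F eF] : forall i, exists q, along xi (f i) = q * 'X^(M.+1).
  by move=> i; apply/dvdpP.
pose J0 := map_mx (meval a) (jacobian f).
have J0u : J0 \in unitmx by rewrite unitmxE det_map_mx unitfE.
pose y := - (invmx J0 *m \col_i (F i).[0]).
pose eta (i : 'I_(c + d)) : {poly K} :=
  match split i with inl j => (y j 0)%:P | inr _ => 0 end.
exists (fun i => xi i + 'X^(M.+1) * eta i).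
have eta_l j : eta (lshift d j) = (y j 0)%:P.
  by rewrite /eta; case: split_ordP => [k /lshift_inj ->//|k /eqP]; rewrite eq_lrshift.
have eta_r k : eta (rshift c k) = 0.
  by rewrite /eta; case: split_ordP => // j /eqP; rewrite eq_rlshift.
split=> [k|i|i].
- by rewrite xit eta_r mulr0 addr0.
- by rewrite hornerD hornerM hornerXn expr0n mul0r addr0.
have [q ->] := along_taylor xi eta M (f i).
apply: dvdp_add; last exact: dvdp_mulr.
rewrite eF mulrC -mulrDr exprSr dvdp_mul2l ?expf_neq0 ?polyX_eq0//.
rewrite -['X]subr0 dvdp_XsubCl /root hornerD /derivation horner_sum.
rewrite big_split_ord /= [X in _ + (_ + X)]big1 ?addr0; last first.
  by move=> k _; rewrite eta_r mulr0 horner0.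
have -> : \sum_(j < c) (along xi (mderiv (lshift d j) (f i)) * eta (lshift d j)).[0] =
    (J0 *m y) i 0.
  rewrite mxE; apply: eq_bigr => j _.
  by rewrite eta_l hornerM hornerC horner_along (meval_eq _ xi0) !mxE.
by rewrite /y mulmxN mulmxA mulmxV// mul1mx !mxE subrr.
Qed.

Variables (E : idomainType) (pi : {rmorphism R -> E}).
Hypothesis kerpi : forall p, pi p = 0 <-> exists k (g : 'I_c -> R),
  p ^+ k = \sum_(i < c) g i * f i.

(** A power of p is in the ideal (f), so p vanishes along xi to high order as soon
as all f_i do; how high is independent of xi. *)
Lemma along_radical p m : pi p = 0 -> exists M, forall xi,
  (forall i, 'X^M %| along xi (f i)) -> 'X^m %| along xi p.
Proof.
move=> /kerpi[k [g e]]; exists (k * m).+1 => xi xif.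
have h : 'X^((k * m).+1) %| along xi p ^+ k.
  rewrite -rmorphXn e rmorph_sum /=.
  apply: (big_ind (fun q => 'X^((k * m).+1) %| q)); first exact: dvdp0.
    by move=> x y; exact: dvdp_add.
  by move=> i _; rewrite rmorphM /= dvdp_mull.
case: k {e xif} h => [|k] h.
  move: h; rewrite expr0 => /(dvdp_leq (oner_neq0 _)).
  by rewrite size_polyXn size_poly1.
rewrite -(@dvdp_pexp2r _ _ _ k.+1)// -exprM mulnC; apply: dvdp_trans h.
by rewrite dvdp_exp2l.
Qed.

Lemma relation_eq0 i : pi (f i) = 0.
Proof.
apply/kerpi; exists 1%N, (fun j => (j == i)%:R); rewrite expr1 (bigD1 i)//= eqxx.
by rewrite mul1r big1 ?addr0// => j /negPf ->; rewrite mul0r.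
Qed.

(** Otherwise a power of the Jacobian would be in (f) and hence vanish at a. *)
Lemma jacobian_neq0 : pi (\det (jacobian f)) != 0.
Proof.
apply/eqP => /kerpi[k [g ek]].
have: meval a (\det (jacobian f)) ^+ k == 0.
  rewrite -rmorphXn ek rmorph_sum big1// => i _.
  by rewrite rmorphM /= fa mulr0.
by rewrite expf_eq0 (negPf Ja) andbF.
Qed.

Hypothesis infK : forall q : {poly K}, q != 0 -> exists x, q.[x] != 0.

(** The line over which the curves lie joins the base coordinates of a (at time 0)
to those of a point tau with r(tau) <> 0 (at time 1), where r is a multiple of Z
in the base. Since r restricted to that line is a fixed nonzero polynomial, it
bounds the order of Z along every sufficiently accurate curve. A relation
between base coordinates vanishes along the curves to every order but depends
on the line only, so it vanishes identically. *)
Lemma generic_curve (Z : R) (h : 'I_c -> R) : pi Z != 0 ->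
  (forall j, pi (h j) = 0) ->
  exists rho, forall m, exists xi : 'I_(c + d) -> {poly K},
    [/\ forall i, (xi i).[0] = a i,
        forall p, p \in gen (stage 0) -> pi p = 0 -> along xi p = 0,
        ~~ ('X^(rho.+1) %| along xi Z) &
        forall j, 'X^m %| along xi (h j)].
Proof.
move=> Z0 h0.
have sep := separable_relation_ex relation_eq0 jacobian_neq0.
have [r [w [gr r0 e]]] := multiple_in_base sep Z0.
have {}r0 : r != 0 by apply: contraNneq r0 => ->; rewrite raddf0.
have [tau rtau] := meval_neq0 infK r0.
pose th k := (a (rshift c k))%:P + 'X * (tau (rshift c k) - a (rshift c k))%:P.
have th0 k : (th k).[0] = a (rshift c k).
  by rewrite hornerD hornerM hornerX mul0r addr0 hornerC.
have stage0P (i : 'I_(c + d)) : stage 0 i -> exists k, i = rshift c k.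
  rewrite /stage /=; case: (split_ordP i) => [j ->|k -> _]; last by exists k.
  by rewrite /= leqNgt ltn_ord.
have indep xi xi' p : (forall k, xi (rshift c k) = th k) ->
    (forall k, xi' (rshift c k) = th k) -> p \in gen (stage 0) ->
    along xi p = along xi' p.
  by move=> e1 e2; apply: gen_along => i /stage0P[k ->]; rewrite e1 e2.
have [xi0 [xi0t _ _]] := approximate_curve 0 th0.
have r1 : along xi0 r != 0.
  apply: contraNneq rtau => /(congr1 (fun q => q.[1])); rewrite horner0 horner_along.
  move=> <-; apply/eqP; apply: gen_meval gr => i /stage0P[k ->].
  by rewrite xi0t hornerD hornerM hornerX mul1r !hornerC addrC subrK.
exists (size (along xi0 r)) => m.
have [M0 M0P] : exists M, forall xi, (forall i, 'X^M %| along xi (f i)) ->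
    'X^((size (along xi0 r)).+1) %| along xi (Z * w - r).
  by apply: along_radical; rewrite rmorphB e subrr.
have /choice[M MP] : forall j, exists M, forall xi,
    (forall i, 'X^M %| along xi (f i)) -> 'X^m %| along xi (h j).
  by move=> j; apply: along_radical.
have [xi [xit xi_0 xif]] := approximate_curve (M0 + \sum_j M j) th0.
have dvd M' : (M' <= M0 + \sum_j M j)%N -> forall i, 'X^M' %| along xi (f i).
  by move=> lM i; apply: dvdp_trans (xif i); rewrite dvdp_exp2l.
exists xi; split=> //.
- move=> p gp p0; apply/eqP; apply: contrapT => /negP p1.
  have [N NP] := along_radical (size (along xi p)).+1 p0.
  have [xi' [xi't _ xi'f]] := approximate_curve N th0.
  have := NP xi' xi'f; rewrite -(indep xi xi' p)// => /(dvdp_leq p1).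
  by rewrite size_polyXn ltnNge leqnSn.
- apply/negP => dZ; have := M0P xi (dvd _ (leq_addr _ _)).
  rewrite rmorphB rmorphM /= dvdp_subr; last by rewrite dvdp_mulr.
  rewrite (indep xi xi0)// => /(dvdp_leq r1).
  by rewrite size_polyXn ltnNge leqnSn.
- by move=> j; apply: MP; apply: dvd; rewrite (bigD1 j)//= addnCA leq_addr.
Qed.

End Curves.

(** * The maximal ideal and one-variable Hensel lifting *)

Section ValuationIdeal.
Variables (K : fieldType) (G : orderedGroupType) (v : valuation K G).
Local Notation O := (valuation_ring_pred v).

(** The maximal ideal of the valuation ring, inside K. *)
Definition maximal_pred : {pred K} := [pred x | (x == 0) || (0 < v x)].
Local Notation M := maximal_pred.

Lemma valuationV x : x != 0 -> v x^-1 = - v x.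
Proof.
move=> x0; apply: (addIr (v x)); rewrite addNr -valuationM ?invr_neq0//.
by rewrite mulVf// valuation1.
Qed.

Lemma valuation_lt_div c x : c != 0 -> x != 0 -> (v c < v x) = (x / c \in M).
Proof.
move=> c0 x0; rewrite inE mulf_eq0 invr_eq0 (negPf c0) (negPf x0) /=.
rewrite valuationM ?invr_neq0// valuationV// !lt_def; congr (_ && _).
  by rewrite subr_eq0.
apply/idP/idP => [h|/(ordered_group_leD2r (v c))]; last by rewrite add0r subrK.
by have := ordered_group_leD2r (- v c) _ _ h; rewrite subrr.
Qed.

Lemma maximal_sub x : x \in M -> x \in O.
Proof. by rewrite !inE => /orP[->//|/ltW ->]; rewrite orbT. Qed.

Lemma maximal0 : 0 \in M. Proof. by rewrite inE eqxx. Qed.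

Lemma maximal1 : (1 : K) \notin M.
Proof. by rewrite inE oner_eq0 valuation1 ltxx. Qed.

Lemma maximalMl x y : x \in O -> y \in M -> x * y \in M.
Proof.
rewrite !inE mulf_eq0; case: eqVneq => //= x0 vx; case: eqVneq => //= y0 vy.
rewrite valuationM//; apply: lt_le_trans vy _.
by rewrite -[leLHS]add0r; apply: ordered_group_leD2r.
Qed.

Lemma maximalMr x y : x \in M -> y \in O -> x * y \in M.
Proof. by move=> xM yO; rewrite mulrC maximalMl. Qed.

Lemma maximalD x y : x \in M -> y \in M -> x + y \in M.
Proof.
rewrite !inE; case: (eqVneq x 0) => [->|x0 /= vx]; first by rewrite add0r.
case: (eqVneq y 0) => [->|y0 /= vy]; first by rewrite addr0 vx orbT.
case: (eqVneq (x + y) 0) => //= xy0; apply: lt_le_trans (valuationD v x0 y0 xy0).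
by rewrite /Order.min; case: ifP.
Qed.

Lemma maximalN x : x \in M -> - x \in M.
Proof. by move=> xM; rewrite -mulN1r maximalMl// rpredN1. Qed.

Lemma maximal_inv x : x \notin O -> x^-1 \in M.
Proof.
rewrite !inE negb_or => /andP[x0]; rewrite invr_eq0 (negPf x0)/= valuationV//.
have /orP[->//|vx0 vx] := ordered_group_total 0 (v x).
rewrite lt_def oppr_eq0; apply/andP; split.
  by apply: contraNneq vx => ->.
by have := ordered_group_leD2r (- v x) _ _ vx0; rewrite subrr add0r.
Qed.

Lemma unit_inv x : x \in O -> x \notin M -> x^-1 \in O.
Proof.
move=> xO xM; apply: contraNT xM => /maximal_inv; by rewrite invrK.
Qed.

Lemma maximal_1D x : x \in M -> (1 + x != 0) /\ (1 + x)^-1 \in O.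
Proof.
move=> xM; have h : 1 + x \notin M.
  by apply: contraNN maximal1 => h; rewrite -(addrK x 1) maximalD ?maximalN.
split; first by apply: contraNneq h => ->; exact: maximal0.
by apply: unit_inv h; rewrite rpredD ?rpred1 ?maximal_sub.
Qed.

Lemma invertible_maximalP (a : valuation_ring v) : invertible a <-> val a \notin M.
Proof.
split=> [[b /(congr1 val)]|aM].
  rewrite rmorphM rmorph1 => ab; apply: contraNN maximal1 => aM.
  by rewrite -ab maximalMr// (valP b).
exists (Sub (val a)^-1 (unit_inv (valP a) aM)); apply: val_inj.
rewrite rmorphM rmorph1 /= mulfV//.
apply: contraNneq aM => a0; rewrite -[val a]/(sval a) a0; exact: maximal0.
Qed.

Hypothesis hens : henselian_local_ring (valuation_ring v).

(** Modulo the maximal ideal the polynomial is 'X^n * ('X - 1), of which 1 is a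
simple root. *)
Lemma hensel_near_one (H : {poly K}) n : (size H <= n)%N ->
  (forall i, H`_i \in M) ->
  exists2 w, root ('X^(n.+1) - 'X^n + H) w & w != 0 /\ w^-1 \in O.
Proof.
move=> sH HM; pose A := valuation_ring v.
pose H' : {poly A} := \poly_(i < size H) insubd (0 : A) H`_i.
have eH : map_poly val H' = H.
  apply/polyP => i; rewrite coef_map coef_poly; case: ltnP => iH.
    exact: (insubdK _ (maximal_sub (HM i))).
  by rewrite raddf0 nth_default.
pose f : {poly A} := 'X^(n.+1) - 'X^n + H'.
have sf : (size ((- 'X^n + H' : {poly A})%R) < size ('X^(n.+1) : {poly A})%R)%N.
  rewrite size_polyXn ltnS (leq_trans (size_polyD _ _))// geq_max size_polyN.
  by rewrite size_polyXn leqnn (leq_trans (size_poly _ _))// ltnW// ltnS.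
have fm : f \is monic.
  by rewrite monicE /f -addrA lead_coefDl// lead_coefXn.
have HM1 (q : {poly K}) : (forall i, q`_i \in M) -> q.[1] \in M.
  move=> qM; rewrite horner_coef; apply: (big_ind (fun x => x \in M)) => [|x y|i _].
  - exact: maximal0.
  - exact: maximalD.
  - by rewrite expr1n mulr1.
have ef : map_poly val f = 'X^(n.+1) - 'X^n + H.
  rewrite /f rmorphD rmorphB /= eH; congr (_ - _ + _);
    exact: (map_polyXn (val : {rmorphism valuation_ring v -> K})).
have valf a : val f.[a] = ('X^(n.+1) - 'X^n + H).[val a].
  by rewrite -ef horner_map.
have [||a fa aM] := hens.2 f 1 fm.
- rewrite invertible_maximalP => /negP; apply; apply/negPn/negPn.
  by rewrite valf rmorph1 !hornerD hornerN !hornerXn !expr1n subrr add0r HM1.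
- rewrite invertible_maximalP -horner_map -deriv_map ef rmorph1.
  rewrite !derivE !hornerD hornerN !hornerMn !hornerXn !expr1n.
  rewrite mulrS addrK; apply: contraNN maximal1 => h.
  rewrite -(addrK (H^`()).[1] 1) maximalD// maximalN// HM1// => i.
  by rewrite coef_deriv -mulr_natr maximalMr// rpred_nat.
exists (val a); first by rewrite /root -valf fa rmorph0.
have a1 : val a \notin M.
  apply/negP => a0M; apply: aM; rewrite invertible_maximalP rmorphB rmorph1 /=.
  apply: contraNN maximal1 => h.
  have -> : (1 : K) = val a - (val a - 1) by ring.
  by rewrite maximalD// maximalN.
split; first by apply: contraNneq a1 => ->; exact: maximal0.
by apply: unit_inv a1; exact: (valP a).
Qed.

(** Newton's correction is z * P(x) / P'(x) with z close to 1. The Taylor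
coefficients of P(x - z * P(x) / P'(x)) / P(x) in z are 1, -1 and then elements
of the maximal ideal; the equation becomes monic in w = z^-1. *)
Lemma hensel_root (P : {poly K}) (x : K) : P.[x] != 0 -> P^`().[x] != 0 ->
  (forall k, P^`N(k.+2).[x] * P.[x] ^+ k.+1 / P^`().[x] ^+ k.+2 \in M) ->
  exists2 z, z \in O & root P (x - z * (P.[x] / P^`().[x])).
Proof.
move=> P0 P1 PM; set eta := P.[x] / _.
have sP : (1 < size P)%N.
  rewrite ltnNge; apply: contraNN P1 => /size1_polyC ->.
  by rewrite derivC horner0.
pose n := (size P).-2.
pose e k := P^`N(k).[x] * (- eta) ^+ k / P.[x].
have e0 : e 0 = 1 by rewrite /e nderivn0 expr0 mulr1 mulfV.
have e1 : e 1%N = -1.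
  by rewrite /e nderivn1 expr1 /eta mulrN mulrCA mulrA mulfK// mulNr mulfV.
have eM k : e k.+2 \in M.
  have -> : e k.+2 = (-1) ^+ k *
      (P^`N(k.+2).[x] * P.[x] ^+ k.+1 / P^`().[x] ^+ k.+2).
    rewrite /e /eta [in LHS]exprNn expr_div_n !exprS; field.
    by rewrite P0 P1 ?expf_neq0.
  by rewrite maximalMl// rpredX// rpredN1.
(* multiplying the expansion by w ^+ n.+1 reverses the order of coefficients *)
pose H := \poly_(i < n) e (n.+1 - i)%N.
have [||w rw [w0 wO]] := @hensel_near_one H n; first exact: size_poly.
  move=> i; rewrite coef_poly; case: ltnP => [lin|_]; last exact: maximal0.
  have -> : (n.+1 - i = (n.+1 - i).-2.+2)%N by lia.
  exact: eM.
exists w^-1 => //; apply/rootP.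
rewrite nderiv_taylor; last exact: mulrC.
have -> : size P = n.+2 by rewrite /n; case: (size P) sP => [|[]].
have eq k : P^`N(k).[x] * (- (w^-1 * eta)) ^+ k = P.[x] * (e k * w^-1 ^+ k).
  by rewrite /e -mulrN exprMn; field; rewrite ?P0 ?w0.
under eq_bigr do rewrite eq.
rewrite -mulr_sumr; apply/eqP; rewrite mulf_eq0 (negPf P0) /=.
rewrite -(mulrI_eq0 _ (mulfI (expf_neq0 n.+1 w0))).
move: rw; rewrite /root !hornerD hornerN !hornerXn => /eqP rw; apply/eqP; rewrite -[RHS]rw.
rewrite !big_ord_recl e0 e1 expr0 mul1r expr1 mulN1r !mulrDr mulr1 addrA.
congr (_ + _); first by rewrite mulrN exprSr mulfK.
rewrite horner_poly mulr_sumr (reindex_inj rev_ord_inj) /=.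
apply: eq_bigr => i _; rewrite /bump /= !add1n.
have -> : ((n - i.+1).+2 = n.+1 - i)%N by case: i => /= i; lia.
rewrite exprVn mulrCA; congr (_ * _).
apply: (mulIf (expf_neq0 (n.+1 - i)%N w0)); rewrite mulfVK ?expf_neq0//.
by rewrite -exprD; congr (_ ^+ _); case: i => /= i; lia.
Qed.

End ValuationIdeal.

(** * Growth of functions near zero *)

Section Germs.
Variables (K : fieldType) (G : orderedGroupType) (v : valuation K G).
Local Notation O := (valuation_ring_pred v).
Local Notation M := (maximal_pred v).
Hypothesis nontriv : nontrivial_valuation v.

(** The filter of punctured neighbourhoods of 0, with radii in K and expressed
through the maximal ideal. *)
Definition near_zero : set_system K :=
  [set A | exists2 c : K, c != 0 & forall s, s != 0 -> s / c \in M -> A s].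

Lemma maximal_neq0 : exists2 x, x != 0 & x \in M.
Proof.
have [x x0 vx] := nontriv.
have /orP[v0|v0] := ordered_group_total 0 (v x).
  by exists x => //; rewrite inE lt_def vx v0 orbT.
exists x^-1; first by rewrite invr_eq0.
rewrite inE valuationV// invr_eq0 (negPf x0) lt_def oppr_eq0 vx /=.
by have := ordered_group_leD2r (- v x) _ _ v0; rewrite subrr add0r.
Qed.

Global Instance near_zero_filter : ProperFilter near_zero.
Proof.
have [x x0 xM] := maximal_neq0; split.
  by move=> [c c0] /(_ (x * c)); apply; rewrite ?mulf_neq0// mulfK.
split=> [|A B [c c0 cA] [e e0 eB]|A B sAB [c c0 cA]].
- by exists 1; rewrite ?oner_neq0.
- have [ceO|/maximal_inv ceM] := boolP (c / e \in O).
    exists c => // s s0 sc; split; first exact: cA.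
    by apply: eB => //; rewrite -[s](mulfVK c0) -mulrA maximalMr.
  exists e => // s s0 se; split; last exact: eB.
  apply: cA => //; rewrite -[s](mulfVK e0) -mulrA -(invf_div c e) maximalMr//.
  exact: maximal_sub.
- by exists c => // s s0 sc; apply: sAB; apply: cA.
Qed.

(** The bound C is taken in the valuation ring so that bounds can be multiplied
together. *)
Definition bounded (phi : K -> K) : Prop :=
  exists C, [/\ C != 0, C \in O & \forall s \near near_zero, C * phi s \in O].

Lemma near_zero_neq0 : \forall s \near near_zero, s != 0.
Proof. by exists 1; rewrite ?oner_neq0. Qed.

Lemma boundedE (phi psi : K -> K) :
  (\forall s \near near_zero, phi s = psi s) -> bounded phi -> bounded psi.
Proof.
move=> e [C [C0 CO Cphi]]; exists C; split=> //.
by apply: filterS2 e Cphi => s <-.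
Qed.

Lemma bounded_const a : bounded (fun=> a).
Proof.
have [aO|aO] := boolP (a \in O).
  by exists 1; split; rewrite ?oner_neq0 ?rpred1//; apply: nearW => s; rewrite mul1r.
have a0 : a != 0 by apply: contraNneq aO => ->; exact: rpred0.
exists a^-1; split; rewrite ?invr_eq0//; first exact/maximal_sub/maximal_inv.
by apply: nearW => s; rewrite mulVf// rpred1.
Qed.

Lemma bounded_O phi : (\forall s \near near_zero, phi s \in O) -> bounded phi.
Proof.
move=> h; exists 1; split; rewrite ?oner_neq0 ?rpred1//.
by apply: filterS h => s; rewrite mul1r.
Qed.

Lemma bounded_id : bounded id.
Proof.
apply: bounded_O; exists 1; rewrite ?oner_neq0// => s _.
by rewrite divr1 => /maximal_sub.
Qed.

Lemma boundedD phi psi : bounded phi -> bounded psi -> bounded (fun s => phi s + psi s).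
Proof.
move=> [C [C0 CO Cphi]] [D [D0 DO Dpsi]]; exists (C * D).
split; rewrite ?mulf_neq0 ?rpredM//; apply: filterS2 Cphi Dpsi => s h1 h2.
rewrite mulrDr {1}(mulrC C) -!mulrA; apply: rpredD; exact: rpredM.
Qed.

Lemma boundedM phi psi : bounded phi -> bounded psi -> bounded (fun s => phi s * psi s).
Proof.
move=> [C [C0 CO Cphi]] [D [D0 DO Dpsi]]; exists (C * D).
split; rewrite ?mulf_neq0 ?rpredM//; apply: filterS2 Cphi Dpsi => s h1 h2.
by rewrite mulrACA rpredM.
Qed.

Lemma boundedX phi k : bounded phi -> bounded (fun s => phi s ^+ k).
Proof.
move=> h; elim: k => [|k IH].
  by apply: boundedE (bounded_const 1); apply: nearW => s; rewrite expr0.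
by apply: boundedE (boundedM h IH); apply: nearW => s; rewrite exprS.
Qed.

Lemma bounded_poly (q : {poly K}) : bounded (horner q).
Proof.
elim/poly_ind: q => [|q a IH].
  by apply: boundedE (bounded_const 0); apply: nearW => s; rewrite horner0.
apply: boundedE (boundedD (boundedM IH bounded_id) (bounded_const a)).
by apply: nearW => s; rewrite hornerMXaddC.
Qed.

Lemma bounded_small phi : bounded phi -> \forall s \near near_zero, s * phi s \in M.
Proof.
move=> [C [C0 CO Cphi]].
have : \forall s \near near_zero, s / C \in M by exists C.
move=> h; apply: filterS2 h Cphi => s sC Cs.
have -> : s * phi s = s / C * (C * phi s) by field.
exact: maximalMr.
Qed.

Definition bigO (m : nat) (phi : K -> K) := bounded (fun s => phi s / s ^+ m).

Lemma bigOE m (phi psi : K -> K) :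
  (\forall s \near near_zero, phi s = psi s) -> bigO m phi -> bigO m psi.
Proof. by move=> e; apply: boundedE; apply: filterS e => s ->. Qed.

Lemma bigO_const0 m : bigO m (fun=> 0).
Proof. by apply: boundedE (bounded_const 0); apply: nearW => s; rewrite mul0r. Qed.

Lemma bigOD m phi psi : bigO m phi -> bigO m psi -> bigO m (fun s => phi s + psi s).
Proof.
by move=> h1 h2; apply: boundedE (boundedD h1 h2); apply: nearW => s; rewrite mulrDl.
Qed.

Lemma bigOM m phi psi : bounded phi -> bigO m psi -> bigO m (fun s => phi s * psi s).
Proof.
by move=> h1 h2; apply: boundedE (boundedM h1 h2); apply: nearW => s; rewrite mulrA.
Qed.

Lemma bigO_le k m phi : (k <= m)%N -> bigO m phi -> bigO k phi.
Proof.
move=> km h; apply: boundedE (boundedM h (boundedX (m - k) bounded_id)).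
apply: filterS near_zero_neq0 => s s0; rewrite /=.
by rewrite -{1}(subnK km) exprD; field; rewrite !expf_neq0.
Qed.

Lemma bigO_poly m (q : {poly K}) : 'X^m %| q -> bigO m (horner q).
Proof.
move=> /dvdpP[r ->]; apply: boundedE (bounded_poly r).
apply: filterS near_zero_neq0 => s s0.
by rewrite hornerM hornerXn mulfK// expf_neq0.
Qed.

Lemma bigO_bounded m phi : bigO m phi -> bounded phi.
Proof.
move=> /(bigO_le (leq0n m)); apply: boundedE; apply: nearW => s.
by rewrite expr0 divr1.
Qed.

(** The function is u times an element of 1 plus the maximal ideal. *)
Lemma near_unit u phi : u != 0 -> bounded phi ->
  (\forall s \near near_zero, u + s * phi s != 0) /\
  bounded (fun s => (u + s * phi s)^-1).
Proof.
move=> u0 h.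
have {}h : \forall s \near near_zero, s * phi s / u \in M.
  apply: filterS (bounded_small (boundedM h (bounded_const u^-1))) => s.
  by rewrite mulrA.
have e s : u + s * phi s = u * (1 + s * phi s / u) by field.
split; first by apply: filterS h => s /maximal_1D[h _]; rewrite e mulf_neq0.
have h' : \forall s \near near_zero, (1 + s * phi s / u)^-1 \in O.
  by apply: filterS h => s /maximal_1D[].
apply: boundedE (boundedM (bounded_const u^-1) (bounded_O h')).
by apply: nearW => s; rewrite e invfM.
Qed.

(** phi is bounded below by a multiple of s ^+ r. *)
Definition order_le (r : nat) (phi : K -> K) :=
  (\forall s \near near_zero, phi s != 0) /\ bounded (fun s => s ^+ r / phi s).

Lemma order_le_poly r (q : {poly K}) : ~~ ('X^(r.+1) %| q) -> order_le r (horner q).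
Proof.
move=> nq; have q0 : q != 0 by apply: contraNneq nq => ->; exact: dvdp0.
have [k [q' q'0 eq]] := multiplicity_XsubC q 0.
rewrite q0 subr0 /= in q'0 eq.
have kr : (k <= r)%N.
  rewrite leqNgt; apply: contraNN nq => rk; rewrite eq dvdp_mull// dvdp_exp2l//.
have [t et] : exists t, q' = q'.[0]%:P + 'X * t.
  have /factor_theorem[t e] : root (q' - q'.[0]%:P) 0.
    by rewrite /root hornerD hornerN hornerC subrr.
  by exists t; rewrite mulrC -['X]subr0 -e addrC subrK.
have qE s : q.[s] = (q'.[0] + s * t.[s]) * s ^+ k.
  by rewrite eq hornerM hornerXn {1}et hornerD hornerM hornerC hornerX.
have [h1 h2] := near_unit q'0 (bounded_poly t); split.
  by apply: filterS2 h1 near_zero_neq0 => s h s0; rewrite qE mulf_neq0 ?expf_neq0.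
apply: boundedE (boundedM h2 (boundedX (r - k) bounded_id)).
apply: filterS2 h1 near_zero_neq0 => s h s0; rewrite qE /=.
by rewrite -{2}(subnK kr) exprD; field; rewrite h expf_neq0.
Qed.

(** The quotient psi / phi has the form 1 + s * (bounded). *)
Lemma order_le_perturb r m phi psi : (r < m)%N ->
  bigO m (fun s => psi s - phi s) -> order_le r phi -> order_le r psi.
Proof.
move=> rm h [h1 h2]; rewrite -(subnK rm) in h.
pose chi s := (psi s - phi s) / s ^+ r.+1 * (s ^+ r / phi s).
have bchi : bounded chi by apply: boundedM h2; apply: bigO_le h; rewrite leq_addl.
have [h3 h4] := near_unit (oner_neq0 K) bchi.
have e : \forall s \near near_zero, psi s = phi s * (1 + s * chi s).
  apply: filterS2 h1 near_zero_neq0 => s p0 s0.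
  by rewrite /chi exprS; field; rewrite p0 s0 expf_neq0.
split; first by apply: filterS3 h1 h3 e => s p0 q0 ->; exact: mulf_neq0.
apply: boundedE (boundedM h2 h4); apply: filterS e => s ->.
by rewrite invfM [RHS]mulrA.
Qed.

End Germs.

(** * Lifting one coordinate *)

Section HenselPoints.
Variables (K : fieldType) (G : orderedGroupType) (v : valuation K G).
Local Notation O := (valuation_ring_pred v).
Local Notation M := (maximal_pred v).
Hypothesis nontriv : nontrivial_valuation v.
Hypothesis hens : henselian_local_ring (valuation_ring v).
Local Notation bounded := (bounded v).
Local Notation bigO := (bigO v).
Local Notation order_le := (order_le v).

#[local] Instance near_zero_proper : ProperFilter (near_zero v) :=
  near_zero_filter nontriv.

Section Close.
Variables (n : nat) (xi : 'I_n -> {poly K}) (m : nat).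
Local Notation R := (mpoly n K).

Definition close_to (xh : K -> 'I_n -> K) :=
  forall i, bigO m (fun s => xh s i - (xi i).[s]).

(** Polynomials are Lipschitz on bounded sets. *)
Lemma close_meval xh : close_to xh -> forall p : R,
  bigO m (fun s => meval (xh s) p - (along xi p).[s]) /\
  bounded (fun s => meval (xh s) p).
Proof.
move=> cl p; suff h : bigO m (fun s => meval (xh s) p - (along xi p).[s]).
  split=> //; have := boundedD nontriv (bigO_bounded nontriv h)
    (bounded_poly nontriv (along xi p)).
  by apply: boundedE => //; apply: nearW => s; rewrite subrK.
elim/mpoly_ind_ring: p => [a|i|p q IHp IHq|p q IHp IHq].
- apply: (bigOE nontriv) (bigO_const0 nontriv m); apply: nearW => s.
  by rewrite along_const mevalC hornerC subrr.
- apply: (bigOE nontriv) (cl i); apply: nearW => s.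
  by rewrite along_mvar meval_mvar.
- apply: (bigOE nontriv) (bigOD nontriv IHp IHq); apply: nearW => s.
  by rewrite !rmorphD /= hornerD; ring.
- have bp : bounded (fun s => meval (xh s) p).
    have := boundedD nontriv (bigO_bounded nontriv IHp)
      (bounded_poly nontriv (along xi p)).
    by apply: boundedE => //; apply: nearW => s; rewrite subrK.
  apply: (bigOE nontriv) (bigOD nontriv (bigOM nontriv bp IHq)
    (bigOM nontriv (bounded_poly nontriv (along xi q)) IHp)); apply: nearW => s.
  by rewrite !rmorphM /= hornerM; ring.
Qed.

(** Apply [hensel_root] to P with coefficients evaluated at xh s. With p_k the
k-th divided derivative of P at the i-th coordinate, p_0 = O(s^m) and 1 / p_1 =
O(s^-r), so that for k >= 2 the coefficient p_k p_0^(k-1) / p_1^k is O(s^e) with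
e = m(k-1) - rk > 0 because m > 2r, and it lies in the maximal ideal near 0. *)
Lemma hensel_step xh (i : 'I_n) (P : {poly R}) r :
  (r.*2 < m)%N -> close_to xh ->
  'X^m %| along xi P.[mvar i] ->
  ~~ ('X^(r.+1) %| along xi P^`().[mvar i]) ->
  exists y : K -> K, bigO (m - r) (fun s => y s - xh s i) /\
    \forall s \near near_zero v, root (map_poly (meval (xh s)) P) (y s).
Proof.
move=> rm cl P0 P1.
pose ev s (p : R) := meval (xh s) p.
pose phi k s := ev s (P^`N(k)).[mvar i].
have phiE k s : phi k s = ((map_poly (meval (xh s)) P)^`N(k)).[xh s i].
  by rewrite nderivn_map -(meval_mvar (xh s) i) horner_map.
have bphi k : bounded (phi k) by have [] := close_meval cl (P^`N(k)).[mvar i].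
have O0 : bigO m (phi 0%N).
  have [h _] := close_meval cl P.[mvar i].
  apply: (bigOE nontriv) (bigOD nontriv h (bigO_poly nontriv P0)); apply: nearW => s.
  by rewrite subrK /phi nderivn0.
have [n1 b1] : order_le r (phi 1%N).
  have [h _] := close_meval cl P^`().[mvar i].
  have rm' : (r < m)%N by lia.
  have := order_le_perturb nontriv rm' h (order_le_poly nontriv P1).
  by rewrite /phi nderivn1.
have small k : \forall s \near near_zero v,
    phi k.+2 s * phi 0%N s ^+ k.+1 / phi 1%N s ^+ k.+2 \in M.
  (* one factor s is kept apart, to pass from bounded to small *)
  pose e := (m * k.+1 - r * k.+2).-1.
  pose chi s := phi k.+2 s * ((phi 0%N s / s ^+ m) ^+ k.+1 *
    ((s ^+ r / phi 1%N s) ^+ k.+2 * s ^+ e)).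
  have bchi : bounded chi.
    apply: (boundedM nontriv) => //; apply: (boundedM nontriv).
      exact: boundedX.
    apply: (boundedM nontriv); first exact: boundedX.
    by apply: boundedX => //; exact: bounded_id.
  apply: filterS3 (bounded_small nontriv bchi) (near_zero_neq0 v) n1 => s h s0 p1.
  suff -> : phi k.+2 s * phi 0%N s ^+ k.+1 / phi 1%N s ^+ k.+2 = s * chi s by [].
  rewrite /chi !expr_div_n -!exprM.
  have em : (m * k.+1 = (e.+1 + r * k.+2))%N.
    by rewrite /e; nia.
  rewrite em exprD (exprS s e); field.
  by rewrite !expf_neq0.
have small_all : \forall s \near near_zero v, forall k,
    phi k.+2 s * phi 0%N s ^+ k.+1 / phi 1%N s ^+ k.+2 \in M.
  have h : \forall s \near near_zero v, forall k : 'I_(size P),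
      phi k.+2 s * phi 0%N s ^+ k.+1 / phi 1%N s ^+ k.+2 \in M.
    exact: (@filter_forall K 'I_(size P) (fun k s =>
    phi k.+2 s * phi 0%N s ^+ k.+1 / phi 1%N s ^+ k.+2 \in M) (near_zero v) _
    (fun k => small k)).
  apply: filterS h => s h k; have [kP|Pk] := ltnP k (size P).
    exact: (h (Ordinal kP)).
  rewrite phiE nderivn_poly0 ?horner0 ?mul0r ?maximal0//.
  by rewrite (leq_trans (size_poly _ _))// (leq_trans Pk)//; lia.
have /choice[z zP] : forall s, exists z, z \in O /\
    (phi 1%N s != 0 -> (forall k, phi k.+2 s * phi 0%N s ^+ k.+1 / phi 1%N s ^+ k.+2 \in M) ->
     root (map_poly (meval (xh s)) P) (xh s i - z * (phi 0%N s / phi 1%N s))).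
  move=> s; have [p0|p0] := eqVneq (phi 0%N s) 0.
    exists 0; split; first exact: rpred0.
    by move=> _ _; rewrite mul0r subr0 /root; move: p0; rewrite phiE nderivn0 => ->.
  have [h|nh] := pselect (phi 1%N s != 0 /\ forall k,
      phi k.+2 s * phi 0%N s ^+ k.+1 / phi 1%N s ^+ k.+2 \in M); last first.
    by exists 0; split; [exact: rpred0|move=> h1 h2; case: nh].
  move: h p0; rewrite !phiE nderivn0 nderivn1 => -[h1 h2] p0.
  have [|z zO rz] := hensel_root hens p0 h1.
    by move=> k; have := h2 k; rewrite phiE.
  by exists z.
exists (fun s => xh s i - z s * (phi 0%N s / phi 1%N s)); split; last first.
  by apply: filterS2 n1 small_all => s h1 h2; apply: (zP s).2.
have bz : bounded (fun s => - z s).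
  by apply: bounded_O => //; apply: nearW => s; rewrite rpredN; have [] := zP s.
have h := boundedM nontriv bz (boundedM nontriv O0 b1).
apply: (boundedE nontriv) h.
apply: filterS2 (near_zero_neq0 v) n1 => s s0 p1.
have {1}-> : m = (m - r + r)%N by lia.
by rewrite exprD; field; rewrite p1 !expf_neq0.
Qed.

End Close.
End HenselPoints.

(** * Solutions near a given one *)

Section NearbyPoints.
Variables (K : fieldType) (G : orderedGroupType) (v : valuation K G).
Local Notation M := (maximal_pred v).
Hypothesis nontriv : nontrivial_valuation v.
Hypothesis hens : henselian_local_ring (valuation_ring v).

#[local] Instance near_zero_proper_at : ProperFilter (near_zero v) :=
  near_zero_filter nontriv.

Lemma exists_nonroot (q : {poly K}) : q != 0 -> exists x, q.[x] != 0.
Proof.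
move=> q0; have : ~~ ('X^((size q).+1) %| q).
  by apply/negP => /(dvdp_leq q0); rewrite size_polyXn ltnNge leqnSn.
by move=> /(order_le_poly nontriv)[/filter_ex h _].
Qed.

Variables (c d : nat).
Local Notation R := (mpoly (c + d) K).
Variables (f : 'I_c -> R) (a : 'I_(c + d) -> K).
Hypothesis fa : forall i, meval a (f i) = 0.
Hypothesis Ja : meval a (\det (jacobian f)) != 0.
Variables (E : idomainType) (pi : {rmorphism R -> E}).
Hypothesis kerpi : forall p, pi p = 0 <-> exists k (g : 'I_c -> R),
  p ^+ k = \sum_(i < c) g i * f i.

(** Only the j-th coordinate of xh is changed, to a root of P. A relation p of
stage j.+1 is Q(x_j) with Q over stage j, and lam^k Q = A P up to relations of
stage j, where lam is the leading coefficient; these relations hold at xh by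
hypothesis, and lam does not vanish there near 0. *)
Lemma tower_step (j : 'I_c) (P : {poly R}) xi m r xh :
  P \is a polyOver (gen (stage j)) ->
  separable_relation pi j (map_poly pi P) ->
  (r.*2 < m)%N ->
  'X^m %| along xi P.[mvar (lshift d j)] ->
  ~~ ('X^(r.+1) %| along xi P^`().[mvar (lshift d j)]) ->
  ~~ ('X^(r.+1) %| along xi P`_(size (map_poly pi P)).-1) ->
  close_to v xi m xh ->
  (forall p, p \in gen (stage j) -> pi p = 0 ->
     \forall s \near near_zero v, meval (xh s) p = 0) ->
  exists xh', close_to v xi (m - r) xh' /\
    forall p, p \in gen (stage j.+1) -> pi p = 0 ->
      \forall s \near near_zero v, meval (xh' s) p = 0.
Proof.
move=> PV [Pmin _] rm dP ndP' ndlam cl van.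
have [y [yO yP]] := hensel_step nontriv hens rm cl dP ndP'.
pose xh' s i := if i == lshift d j then y s else xh s i.
exists xh'; split.
  move=> i; rewrite /xh'; case: eqVneq => [->|_]; last first.
    by apply: bigO_le (cl i) => //; exact: leq_subr.
  have h := bigO_le nontriv (leq_subr r m) (cl (lshift d j)).
  apply: (bigOE nontriv) (bigOD nontriv yO h); apply: nearW => s.
  by rewrite addrA subrK.
have agree s q : q \in gen (stage j) -> meval (xh' s) q = meval (xh s) q.
  apply: gen_meval => i; rewrite /xh'; case: eqVneq => // ->.
  by rewrite (negPf (stage_self d j)).
move=> p gp p0; have [Q QV ep] := gen_horner (@stageS c d j) gp.
have Qx : root (map_poly pi Q) (image_var pi j).
  by rewrite /root horner_map_mvar -ep p0.
have [k [A [AS eqn]]] := minimal_relation_dvd Pmin (map_poly_gen_image pi QV) Qx.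
have [A' A'V eA] := gen_image_lift AS.
set lam := P`_(size (map_poly pi P)).-1 in ndlam.
have lamV : lam \in gen (stage j) by apply: (polyOverP PV).
have elam : pi lam = lead_coef (map_poly pi P) by rewrite /lam -coef_map.
pose h := lam ^+ k *: Q - A' * P.
have hV : h \is a polyOver (gen (stage j)).
  by rewrite rpredB ?rpredM// polyOverZ// rpredX.
have h0 : map_poly pi h = 0.
  by rewrite rmorphB /= map_polyZ rmorphM rmorphXn /= elam eA eqn subrr.
have nh : \forall s \near near_zero v, forall i : 'I_(size h), meval (xh s) h`_i = 0.
  apply: (@filter_forall K 'I_(size h) (fun i s => meval (xh s) h`_i = 0)
    (near_zero v) _) => i.
  apply: van; first exact: (polyOverP hV).
  by rewrite -coef_map h0 coef0.
have nlam : \forall s \near near_zero v, meval (xh s) lam != 0.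
  have [clo _] := close_meval nontriv cl lam.
  have rm' : (r < m)%N by lia.
  by have [] := order_le_perturb nontriv rm' clo (order_le_poly nontriv ndlam).
apply: filterS3 nh nlam yP => s hs ls ys.
have hs0 : map_poly (meval (xh s)) h = 0.
  apply/polyP => i; rewrite coef_map coef0 /=.
  have [ih|hi] := ltnP i (size h); first exact: (hs (Ordinal ih)).
  by rewrite nth_default ?meval0.
have -> : meval (xh' s) p = (map_poly (meval (xh s)) Q).[y s].
  rewrite ep -horner_map /= meval_mvar /xh' eqxx; congr _.[_].
  by apply/polyP => i; rewrite !coef_map; apply: agree; exact: (polyOverP QV).
move: hs0 => /(congr1 (fun q => q.[y s])).
rewrite rmorphB /= map_polyZ rmorphM rmorphXn /= hornerD hornerN hornerZ hornerM.
rewrite (rootP ys) mulr0 subr0 horner0 => /eqP.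
by rewrite mulf_eq0 expf_eq0 (negPf ls) andbF => /eqP.
Qed.

(** Each step loses r orders of accuracy and requires more than 2r of them, so
the curve is taken accurate to order (c + 2) r + 1; after c steps more than r
orders are left, which is what keeps p nonzero. *)
Theorem nearby_point (p : R) (e : K) : pi p != 0 -> e != 0 ->
  exists b : 'I_(c + d) -> K, [/\ forall i, meval b (f i) = 0,
    meval b p != 0 & forall i, (b i - a i) / e \in M].
Proof.
move=> p0 e0.
have pif := relation_eq0 kerpi.
have piJ := jacobian_neq0 fa Ja kerpi.
have /choice[P PP] : forall j : 'I_c, exists P : {poly R}, P \is a polyOver (gen (stage j)) /\
    separable_relation pi j (map_poly pi P).
  move=> j; have [P sP] := separable_relation_ex pif piJ j.
  have [[PS _ _ _] _] := sP; have [P' P'V eP] := gen_image_lift PS.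
  by exists P'; rewrite eP.
pose lam j := (P j)`_(size (map_poly pi (P j))).-1.
pose der j := (P j)^`().[mvar (lshift d j)].
pose Z := p * \prod_j (lam j * der j).
have Z0 : pi Z != 0.
  rewrite rmorphM rmorph_prod mulf_neq0//; apply/prodf_neq0 => j _.
  have [_ [[_ P0 _ _] P1]] := PP j.
  rewrite rmorphM /= mulf_neq0//; first by rewrite /lam -coef_map lead_coef_eq0.
  by move: P1; rewrite deriv_map /root horner_map_mvar.
have h0 j : pi (P j).[mvar (lshift d j)] = 0.
  by have [_ [[_ _ /rootP h _] _]] := PP j; rewrite -horner_map_mvar.
have [r /(_ ((c + 2) * r).+1)[xi [xi0 xiV xiZ xiP]]] :=
  generic_curve fa Ja kerpi exists_nonroot Z0 h0.
have ndp : ~~ ('X^(r.+1) %| along xi p).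
  by apply: contraNN xiZ => h; rewrite rmorphM dvdp_mulr.
have ndj j : ~~ ('X^(r.+1) %| along xi (lam j * der j)).
  apply: contraNN xiZ => h; rewrite /Z (bigD1 j)//= mulrCA rmorphM dvdp_mulr//.
have {xiZ} ndl j : ~~ ('X^(r.+1) %| along xi (lam j)).
  by apply: contraNN (ndj j) => h; rewrite rmorphM dvdp_mulr.
have {ndj} ndd j : ~~ ('X^(r.+1) %| along xi (der j)).
  by apply: contraNN (ndj j) => h; rewrite rmorphM dvdp_mull.
have: forall j, (j <= c)%N -> exists xh, close_to v xi ((c + 2 - j) * r).+1 xh /\
    forall q, q \in gen (stage j) -> pi q = 0 ->
      \forall s \near near_zero v, meval (xh s) q = 0.
  elim=> [_|j IH jc].
    exists (fun s i => (xi i).[s]); split.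
      move=> i; apply: (bigOE nontriv) (bigO_const0 nontriv _); apply: nearW => s.
      by rewrite subrr.
    by move=> q gq q0; apply: nearW => s; rewrite -horner_along xiV// horner0.
  have [xh [cl van]] := IH (ltnW jc); have [PV sP] := PP (Ordinal jc).
  have rm : (r.*2 < ((c + 2 - j) * r).+1)%N.
    by rewrite ltnS -mul2n leq_mul2r; apply/orP; right; lia.
  have dP : 'X^(((c + 2 - j) * r).+1) %|
      along xi (P (Ordinal jc)).[mvar (lshift d (Ordinal jc))].
    apply: dvdp_trans (xiP (Ordinal jc)); rewrite dvdp_exp2l// ltnS.
    by rewrite leq_mul2r leq_subr orbT.
  have [xh' [cl' van']] :=
    tower_step PV sP rm dP (ndd (Ordinal jc)) (ndl (Ordinal jc)) cl van.
  exists xh'; split=> //.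
  suff -> : (((c + 2 - j.+1) * r).+1 = ((c + 2 - j) * r).+1 - r)%N by [].
  have -> : (c + 2 - j = (c + 2 - j.+1).+1)%N by lia.
  by rewrite mulSn -addnS addKn.
move=> /(_ c (leqnn c))[xh [cl van]].
have nf : \forall s \near near_zero v, forall i : 'I_c, meval (xh s) (f i) = 0.
  apply: (@filter_forall K 'I_c (fun i s => meval (xh s) (f i) = 0)
    (near_zero v) _) => i.
  by apply: van (pif i); exact: stage_all.
have np : \forall s \near near_zero v, meval (xh s) p != 0.
  have [clo _] := close_meval nontriv cl p.
  have rm : (r < ((c + 2 - c) * r).+1)%N by rewrite addKn ltnS leq_pmull.
  by have [] := order_le_perturb nontriv rm clo (order_le_poly nontriv ndp).
have nc : \forall s \near near_zero v, forall i : 'I_(c + d), (xh s i - a i) / e \in M.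
  apply: (@filter_forall K 'I_(c + d) (fun i s => (xh s i - a i) / e \in M)
    (near_zero v) _) => i.
  have h : bigO v 1 (fun s => xh s i - a i).
    have h1 := bigO_le nontriv (ltn0Sn ((c + 2 - c) * r)) (cl i).
    have h2 : 'X^1 %| xi i - (a i)%:P.
      rewrite expr1 -['X]subr0 dvdp_XsubCl /root hornerD hornerN hornerC xi0.
      by rewrite subrr.
    apply: (bigOE nontriv) (bigOD nontriv h1 (bigO_poly nontriv h2)).
    by apply: nearW => s; rewrite hornerD hornerN hornerC addrA subrK.
  have := bounded_small nontriv (boundedM nontriv h (bounded_const nontriv e^-1)).
  move=> h'; apply: filterS2 (near_zero_neq0 v) h' => s s0.
  suff -> : s * ((xh s i - a i) / s ^+ 1 / e) = (xh s i - a i) / e by [].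
  by rewrite expr1; field; rewrite e0 s0.
have [s [[h1 h2] h3]] := filter_ex (filterI (filterI nf np) nc).
by exists (xh s).
Qed.

End NearbyPoints.

(** * Quotient by a prime ideal *)

(** Allows a ring morphism to be produced inside a proof. *)
Lemma rmorphism_of (A B : pzRingType) (f : A -> B) :
  zmod_morphism f -> monoid_morphism f ->
  exists F : {rmorphism A -> B}, F =1 f.
Proof.
move=> fB fM.
pose F : {rmorphism A -> B} := HB.pack f (GRing.isZmodMorphism.Build A B f fB)
  (GRing.isMonoidMorphism.Build A B f fM).
by exists F.
Qed.

Section PrimeQuotient.
Variables (R : comNzRingType) (N : set R).

(** The primality proof is an argument so that the quotient structures can be
attached to the predicate. *)
Definition prime_pred of prime_ideal N : {pred R} := fun p => `[< N p >].

Hypothesis N_prime : prime_ideal N.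
Local Notation I := (prime_pred N_prime).

Lemma prime_pred_closed : idealr_closed I.
Proof.
have [N0 N1 ND NM _] := N_prime; split; first exact/asboolP.
  by apply/negP => /asboolP.
by move=> p q r /asboolP Nq /asboolP Nr; apply/asboolP/ND => //; exact: NM.
Qed.

Lemma prime_pred_prime : prime_idealr_closed I.
Proof.
have [_ _ _ _ NP] := N_prime.
by move=> p q /asboolP /NP[] h; apply/orP; [left|right]; apply/asboolP.
Qed.

HB.instance Definition _ := isIdealr.Build R I prime_pred_closed.
HB.instance Definition _ := isPrimeIdealrClosed.Build R I prime_pred_prime.

Definition prime_quotient : Type := {ideal_quot I}.

HB.instance Definition _ := GRing.ComNzRing.on prime_quotient.

Definition prime_quotient_unit : {pred prime_quotient} :=
  fun x => `[< exists y, y * x = 1 >].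

Definition prime_quotient_inv (x : prime_quotient) : prime_quotient :=
  xget x [set y | y * x = 1].

Lemma prime_quotient_mulV :
  {in prime_quotient_unit, left_inverse 1 prime_quotient_inv *%R}.
Proof. by move=> x /asboolP xu; rewrite /prime_quotient_inv; exact: (xgetPex x xu). Qed.

Lemma prime_quotient_unitP (x y : prime_quotient) :
  y * x = 1 -> x \in prime_quotient_unit.
Proof. by move=> xy; apply/asboolP; exists y. Qed.

Lemma prime_quotient_invout :
  {in [predC prime_quotient_unit], prime_quotient_inv =1 id}.
Proof.
move=> x /negP xu; rewrite /prime_quotient_inv xgetPN// => y xy.
by apply: xu; exact: prime_quotient_unitP xy.
Qed.

HB.instance Definition _ := GRing.ComNzRing_hasMulInverse.Build prime_quotient
  prime_quotient_mulV prime_quotient_unitP prime_quotient_invout.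

Lemma prime_quotient_integral (x y : prime_quotient) :
  x * y = 0 -> (x == 0) || (y == 0).
Proof. exact: (@Quotient.rquot_IdomainAxiom R I). Qed.

HB.instance Definition _ := GRing.ComUnitRing_isIntegral.Build prime_quotient
  prime_quotient_integral.

Lemma prime_quotient_ex : exists (E : idomainType) (pi : {rmorphism R -> E}),
  forall p, pi p = 0 <-> N p.
Proof.
pose f (p : R) : prime_quotient := \pi_({ideal_quot I})%qT p.
have fB : zmod_morphism f by exact: (@raddfB _ _ (\pi_({ideal_quot I})%qT)).
have fM : monoid_morphism f.
  split; first exact: (rmorph1 (\pi_({ideal_quot I})%qT)).
  exact: (@rmorphM _ _ (\pi_({ideal_quot I})%qT)).
have [F eF] := rmorphism_of fB fM.
exists prime_quotient, F => p; rewrite eF -(rmorph0 F) eF.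
have := @Quotient.idealrBE R I p 0; rewrite subr0 => e.
split=> [h|Np].
  by have /asboolP : p \in I by rewrite e; apply/eqP.
by have : p \in I by [apply/asboolP]; rewrite e => /eqP.
Qed.

End PrimeQuotient.

(** * Affine opens and rational points *)

Section AffineOpens.
Variables (K : fieldType) (X : kscheme K).

Definition inter_opens (U V : opens X) : opens X :=
  Opens (openI (opens_open U) (opens_open V)).

Lemma invertible_at_open (U : opens X) (s : sect U) :
  open [set y | invertible_at s y].
Proof.
rewrite (_ : [set y | _] =
    \bigcup_(V in [set V : opens X | exists h : V `<=` U, invertible (res h s)]) V).
  by apply: bigcup_open => V _; exact: opens_open.
apply/seteqP; split=> [y [V [h [Vy i]]]|y [V [h i] Vy]]; first by exists V => //; exists h.
by exists V, h.
Qed.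

(** The basic open set D(s). *)
Definition nonvanishing (U : opens X) (s : sect U) : opens X :=
  Opens (invertible_at_open s).

Lemma nonvanishing_sub (U : opens X) (s : sect U) : nonvanishing s `<=` U.
Proof. by move=> y [V [h [Vy _]]]; exact: h. Qed.

Variables (W : opens X) (affW : affine_open W).

Let primeW y (Wy : opens_set W y) :
  prime_ideal [set s : sect W | ~ invertible_at s y].
Proof. by have [h _ _ _] := affW; exact: h. Qed.

(** If D(s) is empty, the ring of sections over it is zero; since W is affine this
ring is the localization of O(W) at s, so s is nilpotent. *)
Lemma nilpotentP (s : sect W) :
  (exists k, s ^+ k = 0) <-> forall y, ~ invertible_at s y.
Proof.
split=> [[k sk] y iy|s0].
  have Wy := nonvanishing_sub iy.
  have [N0 N1 _ _ NP] := primeW Wy.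
  elim: k sk => [|k IH] sk; first by apply: N1; rewrite -(expr0 s) sk.
  have /NP[//|sk'] : [set s : sect W | ~ invertible_at s y] (s * s ^+ k).
    by rewrite -exprS sk.
  elim: k sk' {IH sk} => [|k IH]; first by rewrite expr0.
  by rewrite exprS => /NP[].
pose V : opens X := Opens (@open0 X).
have hV : V `<=` W by [].
have V1 : (1 : sect V) = 0.
  by apply: (@sheaf_separated K X V set0) => // y [].
have [_ _ _ /(_ s V hV)] := affW.
case=> [|_ _ /(_ 1)[|k]].
- by apply/seteqP; split=> // y /s0.
- by rewrite rmorph1.
- by rewrite mul1r; exists k.
Qed.

(** Two nonempty basic open sets of W meet, and s * t is invertible wherever
both s and t are. *)
Lemma irreducible_nilradical_prime (x : X) : irreducible_space X -> opens_set W x ->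
  prime_ideal [set s : sect W | exists k, s ^+ k = 0].
Proof.
move=> [_ irr] Wx; split=> /=.
- by exists 1%N; rewrite expr1.
- by move/nilpotentP => h; have [_ N1 _ _ _] := primeW Wx; apply: N1; exact: h.
- move=> s t /nilpotentP s0 /nilpotentP t0; apply/nilpotentP => y iy.
  have [_ _ ND _ _] := primeW (nonvanishing_sub iy).
  by apply: (ND _ _ (s0 y) (t0 y)).
- move=> s t /nilpotentP t0; apply/nilpotentP => y iy.
  have [_ _ _ NM _] := primeW (nonvanishing_sub iy).
  by apply: (NM s _ (t0 y)).
- move=> s t /nilpotentP st0.
  have [|/existsNP[y /contrapT sy]] := pselect (forall y, ~ invertible_at s y).
    by move/nilpotentP; left.
  have [|/existsNP[z /contrapT tz]] := pselect (forall y, ~ invertible_at t y).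
    by move/nilpotentP; right.
  have [w [sw tw]] := irr _ _ (invertible_at_open s) (invertible_at_open t)
    (ex_intro _ y sy) (ex_intro _ z tz).
  have [_ _ _ _ NP] := primeW (nonvanishing_sub sw).
  by have [] := NP s t (st0 w).
Qed.

Section PointOfMorphism.
Variables (beta : {rmorphism sect W -> K}).
Hypothesis beta_cst : forall c, beta (cst W c) = c.
Variable y : X.
Hypothesis Wy : opens_set W y.
Hypothesis betaP : forall s, beta s = 0 <-> ~ invertible_at s y.

Lemma beta_neq0 s : beta s != 0 -> invertible_at s y.
Proof. by move=> /eqP h; apply: contrapT => /betaP. Qed.

(** A section with zero germ at y is not invertible there. *)
Lemma zero_germ (V : opens X) (h : V `<=` W) (e : sect W) :
  opens_set V y -> res h e = 0 -> beta e = 0.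
Proof.
move=> Vy e0; apply/betaP => -[V' [h' [V'y [b eb]]]].
have : ~ invertible_at (0 : sect W) y by apply/betaP; rewrite rmorph0.
apply; pose U := inter_opens V V'.
have UV : U `<=` V by move=> z [].
have UV' : U `<=` V' by move=> z [].
have UW : U `<=` W := subset_trans UV h.
exists U, UW; split=> //; exists 0.
rewrite mulr0 -(rmorph1 (res UV')) -eb rmorphM (res_comp h' UV' UW).
by rewrite -(res_comp h UV UW) e0 rmorph0 mul0r.
Qed.

(** The value of s at the point y: near y the section s is a fraction a / g of
sections over W with g nonzero at y, and k is the quotient of their values. *)
Definition germ_value (U : opens X) (s : sect U) (k : K) : Prop :=
  exists (V : opens X) (hU : V `<=` U) (hW : V `<=` W) (a g : sect W),
    [/\ opens_set V y, beta g != 0, k * beta g = beta a &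
        res hU s * res hW g = res hW a].

Lemma germ_value_shrink (U : opens X) (s : sect U) (V V' : opens X)
    (hU : V `<=` U) (hW : V `<=` W) (hV : V' `<=` V)
    (hU' : V' `<=` U) (hW' : V' `<=` W) (a g : sect W) :
  res hU s * res hW g = res hW a -> res hU' s * res hW' g = res hW' a.
Proof.
move=> /(congr1 (res hV)); rewrite rmorphM.
by rewrite (res_comp hU hV hU') !(res_comp hW hV hW').
Qed.

Lemma germ_value_common (U : opens X) (s t : sect U) (k l : K) :
  germ_value s k -> germ_value t l ->
  exists (V : opens X) (hU : V `<=` U) (hW : V `<=` W) (a g b h : sect W),
    [/\ opens_set V y,
        beta g != 0 /\ beta h != 0, k * beta g = beta a /\ l * beta h = beta b,
        res hU s * res hW g = res hW a & res hU t * res hW h = res hW b].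
Proof.
move=> [V [hU [hW [a [g [Vy g0 kg e]]]]]] [V' [hU' [hW' [b [h [V'y h0 lh e']]]]]].
have UV : inter_opens V V' `<=` V by move=> z [].
have UV' : inter_opens V V' `<=` V' by move=> z [].
exists (inter_opens V V'), (subset_trans UV hU), (subset_trans UV hW), a, g, b, h.
split=> //; first exact: germ_value_shrink e.
exact: germ_value_shrink e'.
Qed.

Lemma germ_value_fun (U : opens X) (s : sect U) (k l : K) :
  germ_value s k -> germ_value s l -> k = l.
Proof.
move=> sk sl.
have [V [hU [hW [a [g [b [h [Vy [g0 h0] [kg lh] e1 e2]]]]]]]] := germ_value_common sk sl.
have : beta (a * h - b * g) = 0.
  apply: (zero_germ Vy (h := hW)).
  by rewrite rmorphB !rmorphM -e1 -e2 mulrAC subrr.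
rewrite rmorphB !rmorphM -kg -lh => /eqP; rewrite subr_eq0 => /eqP e.
apply: (mulIf g0); apply: (mulIf h0); rewrite e; ring.
Qed.

Lemma germ_value_ex (U : opens X) (s : sect U) : opens_set U y ->
  exists k, germ_value s k.
Proof.
move=> Uy; have [_ _ /(_ (inter_opens U W) y)] := affW.
case=> [z []//|//|g [gy gU]] /(_ g (nonvanishing g) (@nonvanishing_sub _ g) erefl).
have hU : nonvanishing g `<=` U by move=> z /gU[].
move=> [_ /(_ (res hU s))[n [a e]] _].
have g0 : beta g != 0 by apply/eqP => /betaP.
exists (beta a / beta g ^+ n), (nonvanishing g), hU, (@nonvanishing_sub _ g), a, (g ^+ n).
by rewrite !rmorphXn /= mulfVK ?expf_neq0//; split.
Qed.

Lemma germ_valueW s : germ_value s (beta s).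
Proof.
exists W, (@subset_refl _ W), (@subset_refl _ W), s, 1.
by rewrite !rmorph1 !mulr1 oner_neq0.
Qed.

Lemma germ_value_res (U V : opens X) (h : V `<=` U) (s : sect U) k :
  germ_value (res h s) k -> germ_value s k.
Proof.
move=> [V' [hV [hW [a [g [Vy g0 kg e]]]]]].
exists V', (subset_trans hV h), hW, a, g; split=> //.
by rewrite -e (res_comp h hV (subset_trans hV h)).
Qed.

Lemma germ_value_cst (U : opens X) (Uy : opens_set U y) c : germ_value (cst U c) c.
Proof.
have hU : inter_opens U W `<=` U by move=> z [].
have hW : inter_opens U W `<=` W by move=> z [].
exists (inter_opens U W), hU, hW, (cst W c), 1.
by rewrite !rmorph1 !mulr1 oner_neq0 beta_cst !res_cst.
Qed.

Lemma germ_value_invertible (U : opens X) (s : sect U) k :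
  germ_value s k -> k != 0 -> invertible_at s y.
Proof.
move=> [V [hU [hW [a [g [Vy g0 kg e]]]]]] k0.
have [V' [h' [V'y [b eb]]]] : invertible_at a y.
  by apply: beta_neq0; rewrite -kg mulf_neq0.
pose V3 := inter_opens V V'.
have hV : V3 `<=` V by move=> z [].
have hV' : V3 `<=` V' by move=> z [].
exists V3, (subset_trans hV hU); split=> //.
exists (res (subset_trans hV hW) g * res hV' b).
rewrite mulrA (germ_value_shrink hV (subset_trans hV hU) (subset_trans hV hW) e).
by rewrite -(rmorph1 (res hV')) -eb rmorphM (res_comp h' hV' (subset_trans hV hW)).
Qed.

(** Locality at y makes the value of a germ well defined, existence comes from
O(D(g)) being the localization of O(W) at g. *)
Lemma kpoint_of_morphism : exists (z : kpoint X) (Wz : opens_set W (kpt z)),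
  kpt z = y /\ forall s, kval Wz s = beta s.
Proof.
have ex U (Uy : opens_set U y) : exists F : {rmorphism sect U -> K},
    forall s, germ_value s (F s).
  have /choice[f fP] := fun s => germ_value_ex s Uy.
  have fB : zmod_morphism f.
    move=> s t; apply: germ_value_fun (fP _) _.
    have [V [hU [hW [a [g [b [h [Vy [g0 h0] [kg lh] e1 e2]]]]]]]] :=
      germ_value_common (fP s) (fP t).
    exists V, hU, hW, (a * h - b * g), (g * h); split=> //.
    - by rewrite rmorphM mulf_neq0.
    - by rewrite rmorphB !rmorphM -kg -lh; ring.
    - by rewrite !rmorphB !rmorphM -e1 -e2; ring.
  have fM : monoid_morphism f.
    split=> [|s t]; apply: germ_value_fun (fP _) _.
      by rewrite -(rmorph1 (cst U)); exact: germ_value_cst.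
    have [V [hU [hW [a [g [b [h [Vy [g0 h0] [kg lh] e1 e2]]]]]]]] :=
      germ_value_common (fP s) (fP t).
    exists V, hU, hW, (a * b), (g * h); split=> //.
    - by rewrite rmorphM mulf_neq0.
    - by rewrite !rmorphM -kg -lh; ring.
    - by rewrite !rmorphM -e1 -e2; ring.
  have [F eF] := rmorphism_of fB fM.
  by exists F => s; rewrite eF.
pose F U (Uy : opens_set U y) := projT1 (cid (ex U Uy)).
have FP U (Uy : opens_set U y) s : germ_value s (F U Uy s) :=
  projT2 (cid (ex U Uy)) s.
have F_res (U V : opens X) (h : V `<=` U) (hU : opens_set U y)
    (hV : opens_set V y) (s : sect U) : F V hV (res h s) = F U hU s.
  exact: germ_value_fun (germ_value_res (FP V hV (res h s))) (FP U hU s).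
have F_cst (U : opens X) (hU : opens_set U y) (c : K) : F U hU (cst U c) = c.
  exact: germ_value_fun (FP _ _ _) (germ_value_cst hU c).
have F_local (U : opens X) (hU : opens_set U y) (s : sect U) :
    F U hU s != 0 -> invertible_at s y.
  exact: germ_value_invertible (FP _ _ _).
exists (KPoint F_res F_cst F_local), Wy; split=> // s.
exact: germ_value_fun (FP _ _ _) (germ_valueW s).
Qed.

End PointOfMorphism.

(** The underlying point is the kernel of beta, a prime ideal of O(W). *)
Lemma kpoint_of_algebra_morphism (beta : {rmorphism sect W -> K}) :
  (forall c, beta (cst W c) = c) ->
  exists (z : kpoint X) (Wz : opens_set W (kpt z)),
    (forall s, kval Wz s = beta s) /\
    forall s : sect W, beta s != 0 -> invertible_at s (kpt z).
Proof.
move=> beta_cst; have [_ /(_ [set s | beta s = 0])] := affW.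
case=> [|y [[Wy eP] _] _ _].
  split=> [||s t|s t|s t] /=.
  - exact: rmorph0.
  - by rewrite rmorph1; apply/eqP; rewrite oner_eq0.
  - by rewrite rmorphD => -> ->; rewrite addr0.
  - by rewrite rmorphM => ->; rewrite mulr0.
  - by rewrite rmorphM => /eqP; rewrite mulf_eq0 => /orP[]/eqP; [left|right].
have betaP s : beta s = 0 <-> ~ invertible_at s y.
  by rewrite -[beta s = 0]/([set s | beta s = 0] s) eP.
have [z [Wz [ez eb]]] := kpoint_of_morphism beta_cst Wy betaP.
by exists z, Wz; split=> // s; rewrite ez; exact: beta_neq0.
Qed.

End AffineOpens.

(** * The density property *)

Section AffineCoordinates.
Variables (K : fieldType) (X : kscheme K) (W : opens X) (n : nat).
Variable phi : {rmorphism mpoly n K -> sect W}.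
Hypothesis ephi : affine_embedding phi.

Lemma kval_meval (x : kpoint X) (Wx : opens_set W (kpt x)) (p : mpoly n K) :
  kval Wx (phi p) = meval (fun i => kcoord phi Wx 0 i) p.
Proof.
have [phiC _] := ephi; elim/mpoly_ind_ring: p => [a|i|p q IHp IHq|p q IHp IHq].
- by rewrite phiC kval_cst mevalC.
- by rewrite meval_mvar mxE.
- by rewrite !rmorphD /= IHp IHq.
- by rewrite !rmorphM /= IHp IHq.
Qed.

(** Sections over W are polynomials modulo the kernel of phi. *)
Lemma evaluation_morphism (b : 'I_n -> K) :
  (forall p, phi p = 0 -> meval b p = 0) ->
  exists beta : {rmorphism sect W -> K}, forall p, beta (phi p) = meval b p.
Proof.
move=> b0; have [_ /choice[h hP]] := ephi.
have eqb p q : phi p = phi q -> meval b p = meval b q.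
  move=> e; apply/eqP; rewrite -subr_eq0 -rmorphB /= b0//.
  by rewrite rmorphB e subrr.
pose f s := meval b (h s).
have fB : zmod_morphism f.
  by move=> s t; rewrite /f -rmorphB; apply: eqb; rewrite rmorphB !hP.
have fM : monoid_morphism f.
  split=> [|s t]; rewrite /f; last by rewrite -rmorphM; apply: eqb; rewrite rmorphM !hP.
  by rewrite -(rmorph1 (meval b)); apply: eqb; rewrite rmorph1 hP.
have [F eF] := rmorphism_of fB fM.
by exists F => p; rewrite eF; apply: eqb; rewrite hP.
Qed.

End AffineCoordinates.

(** A positive radius smaller than finitely many given ones. *)
Lemma common_radius (K : fieldType) (G : orderedGroupType) (v : valuation K G)
  (n : nat) (r : 'I_n -> K) : nontrivial_valuation v -> (forall i, r i != 0) ->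
  exists2 e, e != 0 & forall x i, x / e \in maximal_pred v ->
    x / r i \in maximal_pred v.
Proof.
move=> nontriv r0.
have near_zero_proper : ProperFilter (near_zero v) := near_zero_filter nontriv.
have h : \forall s \near near_zero v, forall i : 'I_n, s / r i \in maximal_pred v.
  apply: (@filter_forall K 'I_n (fun i s => s / r i \in maximal_pred v)
    (near_zero v) _) => i.
  by exists (r i).
have [e [e0 er]] := filter_ex (filterI (near_zero_neq0 v) h).
exists e => // x i xe; rewrite -[x](mulfVK e0) -mulrA maximalMr//.
exact: maximal_sub.
Qed.

Theorem mainTheorem5 (K : topologicalFieldType) (G : orderedGroupType)
    (v : valuation K G) :
  nontrivial_valuation v ->
  henselian_local_ring (valuation_ring v) ->
  has_valuation_topology v ->
  density_property K.
Proof.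
move=> nontriv hens top X _ smX irrX U [u Uu] S [x Sx] oS.
have [W [c [d [phi [f [Wx affW ephi kerphi [b jb]]]]]]] := smX (kpt x).
pose a i := kcoord phi Wx 0 i.
have ax p : kval Wx (phi p) = meval a p by exact: kval_meval.
have phif i : phi (f i) = 0.
  apply/kerphi; exists (fun j => (j == i)%:R); rewrite (bigD1 i)//= eqxx.
  by rewrite mul1r big1 ?addr0// => j /negPf ->; rewrite mul0r.
have fa i : meval a (f i) = 0 by rewrite -ax phif rmorph0.
have Ja : meval a (\det (jacobian f)) != 0.
  rewrite -ax; apply/eqP => j0.
  move: jb => /(congr1 (kval Wx)); rewrite rmorphM rmorph1 [X in X * _]j0 mul0r.
  by move=> /esym/eqP; rewrite oner_eq0.
have nilW := irreducible_nilradical_prime affW irrX Wx.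
have rad : prime_ideal [set p : mpoly (c + d) K | exists k, phi p ^+ k = 0].
  have [N0 N1 ND NM NP] := nilW; split=> /=.
  - by rewrite rmorph0.
  - by rewrite rmorph1.
  - by move=> p q hp hq; rewrite rmorphD; exact: ND.
  - by move=> p q hq; rewrite rmorphM; exact: NM.
  - by move=> p q; rewrite rmorphM; exact: NP.
have [E [pi piP]] := prime_quotient_ex rad.
have kerpi p : pi p = 0 <-> exists k (g : 'I_c -> mpoly (c + d) K),
    p ^+ k = \sum_(i < c) g i * f i.
  rewrite piP /=; split=> -[k h]; exists k.
    by apply/kerphi; rewrite rmorphXn.
  by rewrite -rmorphXn; apply/kerphi.
have [y [Wy Uy]] := irrX.2 W U (opens_open W) (opens_open U)
  (ex_intro _ _ Wx) (ex_intro _ _ Uu).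
have [_ _ /(_ (inter_opens W U) y)] := affW.
case=> [z []//|//|g [gy gU]] _.
have [p ep] := ephi.2 g.
have p0 : pi p != 0.
  by apply/eqP => /piP /=; rewrite ep => /(nilpotentP affW)/(_ y).
have [B nB sB] := oS W _ phi affW ephi x Wx Sx.
case: nB => P nP sP.
have /choice[r rP] : forall i, exists r, r != 0 /\ valuation_ball v (a i) r `<=` P 0 i.
  by move=> i; have /top[r r0 rP] := nP 0 i; exists r.
have [e e0 er] := common_radius nontriv (fun i => (rP i).1).
have [b' [b'f b'p b'a]] := nearby_point nontriv hens fa Ja kerpi p0 e0.
have [|beta betaP] := @evaluation_morphism _ _ _ _ _ ephi b'.
  move=> q /kerphi[h ->]; rewrite rmorph_sum big1// => i _.
  by rewrite rmorphM /= b'f mulr0.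
have beta_cst k : beta (cst W k) = k by rewrite -ephi.1 betaP mevalC.
have [z [Wz [zb zi]]] := kpoint_of_algebra_morphism affW beta_cst.
exists z; split.
  apply: (sB z Wz); apply: sP => i j; rewrite ord1 mxE zb betaP meval_mvar.
  apply: (rP j).2; rewrite /valuation_ball /=.
  have [->|ba] := eqVneq (b' j) (a j); first by left.
  right; rewrite valuation_lt_div ?(rP j).1 ?subr_eq0//.
  exact: er (b'a j).
suff : invertible_at g (kpt z) by move=> /gU[].
by apply: zi; rewrite -ep betaP.
Qed.
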